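(* Let $F$ be a free group of rank $n \geq 2$. Then there is an algorithm which decides, given $u, v \in F$, whether there exists a monomorphism (injective group homomorphism) $f : F \rightarrow F$ such that $f(u)=v$.
   Context: The rank $n$ is finite. Elements of $F$ are given to the algorithm as words in a fixed free basis $x_1,\dots,x_n$ of $F$ and their inverses. *)

(* Defs.v *)
From mathcomp Require Import all_boot.

Set Implicit Arguments.
Unset Strict Implicit.
Unset Printing Implicit Defensive.

(* Kleene's general recursive functions: the least class of total functions    *)
(* nat^k -> nat that contains the initial functions and is closed under        *)
(* composition, primitive recursion and minimization of regular functions.     *)
(* Each closure rule characterizes its result by pointwise equations, so the   *)
(* class is closed under extensional equality.                                 *)
Inductive recursive : forall k : nat, (k.-tuple nat -> nat) -> Prop :=
| rec_zero k (h : k.-tuple nat -> nat) :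
    (forall t, h t = 0) -> recursive h
| rec_succ (h : 1.-tuple nat -> nat) :
    (forall t, h t = (tnth t ord0).+1) -> recursive h
| rec_proj k (i : 'I_k) (h : k.-tuple nat -> nat) :
    (forall t, h t = tnth t i) -> recursive h
| rec_comp k m (f : m.-tuple nat -> nat) (g : 'I_m -> k.-tuple nat -> nat)
    (h : k.-tuple nat -> nat) :
    recursive f -> (forall i, recursive (g i)) ->
    (forall t, h t = f [tuple g i t | i < m]) -> recursive h
| rec_prim k (f : k.-tuple nat -> nat) (g : k.+2.-tuple nat -> nat)
    (h : k.+1.-tuple nat -> nat) :
    recursive f -> recursive g ->
    (forall t, h (cons_tuple 0 t) = f t) ->
    (forall m t, h (cons_tuple m.+1 t) =
                 g (cons_tuple m (cons_tuple (h (cons_tuple m t)) t))) ->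
    recursive h
| rec_min k (f : k.+1.-tuple nat -> nat) (h : k.-tuple nat -> nat) :
    recursive f ->
    (forall t, f (cons_tuple (h t) t) = 0) ->
    (forall t i, i < h t -> f (cons_tuple i t) <> 0) ->
    recursive h.

(* Words, not necessarily reduced, in x_0, ..., x_(n-1) and their inverses:    *)
(* (i, false) stands for x_i and (i, true) for its inverse.                    *)
Definition letter (n : nat) : Type := ('I_n * bool)%type.
Definition word (n : nat) : Type := seq (letter n).

Definition letter_code n (l : letter n) : nat := l.1.*2 + l.2.
Definition word_code n (w : word n) : nat :=
  CodeSeq.code [seq letter_code l | l <- w].

(* The Boolean test must be recursive on codes: Rocq-level decidability would  *)
(* be void in the presence of classical axioms.                                *)
Definition algorithmically_decidable n (P : word n -> word n -> Prop) : Prop :=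
  exists (d : word n -> word n -> bool) (f : 2.-tuple nat -> nat),
    [/\ recursive f,
        forall u v, f [tuple word_code u; word_code v] = d u v :> nat
      & forall u v, d u v <-> P u v].

Definition free_basis n (F : groupType) (x : 'I_n -> F) : Prop :=
  forall (G : groupType) (g : 'I_n -> G),
    exists f : {multiplicative F -> G},
      (forall i, f (x i) = g i) /\
      (forall f' : {multiplicative F -> G},
         (forall i, f' (x i) = g i) -> f' =1 f).

Definition word_eval n (F : groupType) (x : 'I_n -> F) (w : word n) : F :=
  (\prod_(l <- w) (if l.2 then (x l.1)^-1 else x l.1))%g.

(* Main.v *)
(* Whether some monomorphism sends u to v is decided through two classical
   reductions. By Nielsen reduction, a monomorphism f with f(u) = v factors as
   an automorphism followed by a substitution g whose images of the basis are
   Nielsen reduced. If w is the image of u under the automorphism, then v = g(w)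
   with little cancellation, so the length of w, and the lengths of the g(x) for
   the letters x of w, are at most the length of v; conversely, a Nielsen reduced
   family indexed by some of the letters always extends to all of them, hence
   gives a monomorphism. By Whitehead's peak reduction, u and w are related by a
   chain of Whitehead automorphisms through words no longer than u and w, so a
   finite search finds all candidates for w.

   Peak reduction is proved by contracting edges in blown-up roses: a Whitehead
   automorphism splits the vertex of the rose along a cut A of its directions and
   contracts another edge a instead of the new one, which changes the length of u
   by the number of turns of u cut by A minus the number of occurrences of a.
   The number of cut turns is submodular in A, which allows two crossing cuts to
   be replaced by a corner, and disjoint cuts are handled in a graph with three
   vertices. *)
From HB Require Import structures.
From Stdlib Require Import Classical.
Require Import Defs.
From mathcomp Require Import all_boot.
From mathcomp Require Import zify.

Set Implicit Arguments.
Unset Strict Implicit.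
Unset Printing Implicit Defensive.

(** * Free reduction *)

(** The obstacle to a bounded search is the letters that do not occur in w: nothing bounds their
    images in terms of v. The test therefore asks for Nielsen reducedness on the letters of w alone,
    and the other images are supplied afterwards, where a second basis letter is needed. A Whitehead
    move appears in two guises: geometrically, with an exact length formula, and as an injective
    substitution with images of length at most 5. Its definition allows an arbitrary signed
    relabelling, so permutations of the basis never need separate treatment, and inverses of moves
    are moves because both contract one graph along trees that differ in one edge. The algorithm
    holds as a constant a finite list of substitutions that covers all moves, obtained by classical
    filtering of the short substitutions for injectivity. Injectivity is enough: a member that is
    not an automorphism still composes to a monomorphism, hence causes no wrong positive answer.
    Nielsen reduction yields a chain with some unknown length bound; peak reduction lowers that
    bound to one computable from u and v, and a chain without repetitions has at most as many steps
    as there are words within the bound. *)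

Section FreeReduction.
Variable T : eqType.
Implicit Types (l m : T * bool) (s t u v w : seq (T * bool)).

Definition linv l : T * bool := (l.1, ~~ l.2).

Lemma linvK : involutive linv.
Proof. by case=> i b; rewrite /linv /= negbK. Qed.

Lemma linv_inj : injective linv.
Proof. exact: inv_inj linvK. Qed.

Lemma eq_linv l m : (linv l == m) = (l == linv m).
Proof. exact: inv_eq linvK l m. Qed.

Lemma linv_neq l : (linv l == l) = false.
Proof. by apply/negbTE; case: l => i []; rewrite /linv /= xpair_eqE /= andbF. Qed.

Lemma letter_same l m : l.1 = m.1 -> l = m \/ l = linv m.
Proof.
by case: l m => [i []] [j []] /= <-; rewrite /linv /=; auto.
Qed.

Definition push l s :=
  if s is m :: s' then if m == linv l then s' else l :: s else [:: l].

Definition red s := foldr push [::] s.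

Definition reduced s := sorted (fun l m => m != linv l) s.

Definition winv s := rev (map linv s).

Lemma reduced_cons l s :
  reduced (l :: s) = (if s is m :: _ then m != linv l else true) && reduced s.
Proof. by case: s. Qed.

Lemma reduced_cat s t : reduced (s ++ t) ->  reduced s /\ reduced t.
Proof. by case/cat_sorted2. Qed.

Lemma push_reduced l s : reduced s -> reduced (push l s).
Proof.
case: s => //= m s; case: eqP => [_ | /eqP ne] rs; first exact: path_sorted rs.
by rewrite /= ne.
Qed.

Lemma pushK l s : reduced s -> push l (push (linv l) s) = s.
Proof.
case: s => [|m s] /=; first by rewrite eqxx.
rewrite linvK; case: eqP => [-> | _] rs; last by rewrite /= eqxx.
by case: s rs => //= p s /andP[/negbTE -> _].
Qed.

Lemma red_reduced s : reduced (red s).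
Proof. by elim: s => //= l s IHs; apply: push_reduced. Qed.

Lemma red_id s : reduced s -> red s = s.
Proof.
elim: s => // l s IHs; rewrite reduced_cons /= => /andP[hd rs].
by rewrite IHs //; case: s hd {IHs rs} => //= m s /negbTE ->.
Qed.

Lemma red_idem s : red (red s) = red s.
Proof. exact/red_id/red_reduced. Qed.

Lemma foldr_push_reduced s t : reduced t -> reduced (foldr push t s).
Proof. by move=> rt; elim: s => //= l s IHs; apply: push_reduced. Qed.

Lemma foldr_push l s t : reduced t ->
  foldr push t (push l s) = push l (foldr push t s).
Proof.
move=> rt; case: s => //= m s; case: eqP => // ->.
by rewrite pushK // foldr_push_reduced.
Qed.

Lemma foldr_push_red s t : reduced t -> foldr push t (red s) = foldr push t s.
Proof. by move=> rt; elim: s => //= l s IHs; rewrite foldr_push // IHs. Qed.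

Lemma red_cat s t : red (s ++ t) = red (red s ++ red t).
Proof.
by rewrite /red !foldr_cat -/(red t) -/(red s) -/(red (red t)) red_idem
  foldr_push_red // red_reduced.
Qed.

(** Equality in the free group, with reduced words as normal forms. *)
Definition feq s t := red s = red t.

Lemma feq_red s : feq (red s) s.
Proof. exact: red_idem. Qed.

Lemma feq_sym s t : feq s t -> feq t s. Proof. by []. Qed.

Lemma feq_trans s t u : feq s t -> feq t u -> feq s u.
Proof. by rewrite /feq => ->. Qed.

Lemma feq_cat s s' t t' : feq s s' -> feq t t' -> feq (s ++ t) (s' ++ t').
Proof. by rewrite /feq => es et; rewrite red_cat es et -red_cat. Qed.

Lemma feq_catl s t t' : feq t t' -> feq (s ++ t) (s ++ t').
Proof. exact: feq_cat. Qed.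

Lemma feq_catr s s' t : feq s s' -> feq (s ++ t) (s' ++ t).
Proof. by move/feq_cat; apply. Qed.

Lemma feq_reduced s t : reduced s -> reduced t -> feq s t -> s = t.
Proof. by rewrite /feq => /red_id-> /red_id->. Qed.

Lemma winv_cat s t : winv (s ++ t) = winv t ++ winv s.
Proof. by rewrite /winv map_cat rev_cat. Qed.

Lemma winv_cons l s : winv (l :: s) = winv s ++ [:: linv l].
Proof. by rewrite -cat1s winv_cat. Qed.

Lemma winvK : involutive winv.
Proof. by move=> s; rewrite /winv map_rev revK mapK //; apply: linvK. Qed.

Lemma size_winv s : size (winv s) = size s.
Proof. by rewrite size_rev size_map. Qed.

Lemma reduced_winv s : reduced (winv s) = reduced s.
Proof.
rewrite /reduced rev_sorted sorted_map; apply: eq_sorted => l m /=.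
by rewrite linvK eq_sym.
Qed.

Lemma feq_winvr s : feq (s ++ winv s) [::].
Proof.
elim: s => // l s IHs; rewrite winv_cons -cat1s -catA (catA s).
apply: (feq_trans (t := [:: l] ++ [::] ++ [:: linv l])).
  by apply: feq_catl; apply: feq_catr.
by rewrite /feq /= eqxx.
Qed.

Lemma feq_winvl s : feq (winv s ++ s) [::].
Proof. by rewrite -{2}[s]winvK; apply: feq_winvr. Qed.

Lemma feq_winv s t : feq s t -> feq (winv s) (winv t).
Proof.
move=> st; apply: (@feq_trans _ (winv s ++ (t ++ winv t))).
  by rewrite -{1}[winv s]cats0; apply: feq_catl; apply/feq_sym/feq_winvr.
rewrite catA -[winv t in X in feq _ X]cat0s; apply: feq_catr.
by apply: feq_trans (feq_winvl s); apply: feq_catl.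
Qed.

Lemma red_winv s : red (winv s) = winv (red s).
Proof.
apply: feq_reduced; rewrite ?red_reduced ?reduced_winv ?red_reduced //.
by apply: feq_trans (feq_red _) _; apply/feq_winv/feq_sym/feq_red.
Qed.

Lemma size_push l s : size (push l s) <= (size s).+1.
Proof. by case: s => //= m s; case: ifP => //= _; lia. Qed.

Lemma size_red s : size (red s) <= size s.
Proof. by elim: s => //= l s IHs; apply: leq_trans (size_push _ _) _. Qed.

Fixpoint lcp s t :=
  match s, t with
  | l :: s', m :: t' => if l == m then (lcp s' t').+1 else 0
  | _, _ => 0
  end.

Lemma lcpP s t : exists p s' t',
  [/\ s = p ++ s', t = p ++ t', size p = lcp s t &
      forall l m s1 t1, s' = l :: s1 -> t' = m :: t1 -> l != m].
Proof.
elim: s t => [|l s IHs] [|m t] /=; try by exists [::]; do 2!eexists.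
case: eqP => [<- | ne].
  have [p [s' [t' [-> -> <- h]]]] := IHs t.
  by exists (l :: p), s', t'.
exists [::], (l :: s), (m :: t); split=> // l' m' s1 t1 [<- _] [<- _].
exact/eqP.
Qed.

(* [cp s t] counts the letters of [s] cancelled in the product [s t] *)
Definition cp s t := lcp (winv s) t.

(** Since the cancelled part [p] is maximal, the letters that meet once it is removed do not cancel,
    so what remains is already reduced. *)
Lemma cpP s t : exists p s' t',
  [/\ s = s' ++ winv p, t = p ++ t', size p = cp s t &
      reduced s -> reduced t -> reduced (s' ++ t')].
Proof.
have [p [s' [t' [es et szp h]]]] := lcpP (winv s) t.
have es': s = winv s' ++ winv p by rewrite -winv_cat -es winvK.
exists p, (winv s'), t'; split=> //; rewrite es' et.
move=> /reduced_cat[rs _] /reduced_cat[_ rt].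
case: s' rs h {es es'} => [|l s'] // rs h.
case: t' rt h {et} => [|m t'] rt h; first by rewrite cats0.
have ne : m != l by rewrite eq_sym (h _ _ _ _ erefl erefl).
rewrite winv_cons -catA /=; move: rs; rewrite winv_cons /reduced.
rewrite cats1; case: (winv s') => [|p0 r] /=.
  by move=> _; rewrite linvK ne.
by rewrite cat_path rcons_path => /andP[-> /= ->]; rewrite linvK ne.
Qed.

Lemma cp_split s t : reduced s -> reduced t ->
  red (s ++ t) = take (size s - cp s t) s ++ drop (cp s t) t.
Proof.
have [p [s' [t' [-> -> <- h]]]] := cpP s t; move=> rs rt.
rewrite size_cat size_winv addnK take_size_cat // drop_size_cat //.
apply: feq_reduced; [exact: red_reduced | exact: h | ].
apply: feq_trans (feq_red _) _; rewrite -catA; apply: feq_catl.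
rewrite catA -[in X in feq _ X](cat0s t'); apply: feq_catr.
exact: feq_winvl.
Qed.

Lemma cp_le s t : cp s t <= size s /\ cp s t <= size t.
Proof.
have [p [s' [t' [e1 e2 <- h]]]] := cpP s t.
by rewrite e1 e2 !size_cat size_winv; lia.
Qed.

Lemma size_red_cat s t : reduced s -> reduced t ->
  size (red (s ++ t)) = size s + size t - (cp s t).*2.
Proof.
move=> rs rt; rewrite cp_split // size_cat size_takel ?size_drop; last lia.
by have := cp_le s t; lia.
Qed.

Lemma lcpC s t : lcp s t = lcp t s.
Proof.
by elim: s t => [|l s IHs] [|m t] //=; rewrite eq_sym IHs.
Qed.

Lemma cp_winv s t : cp (winv t) (winv s) = cp s t.
Proof. by rewrite /cp winvK lcpC. Qed.

End FreeReduction.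

(** * Substitutions as endomorphisms of free groups *)

Section Substitution.
Variables (T1 T2 : eqType).
Implicit Types (f g : T1 * bool -> seq (T2 * bool)) (u v w : seq (T1 * bool)).

Definition sb f w := flatten (map f w).

(** Images are given for letters and inverse letters alike; this compatibility is what makes [sb f]
    respect free equality. *)
Definition hom f := forall l, f (linv l) = winv (f l).

Lemma sb_cons f l w : sb f (l :: w) = f l ++ sb f w. Proof. by []. Qed.

Lemma sb_cat f u v : sb f (u ++ v) = sb f u ++ sb f v.
Proof. by rewrite /sb map_cat flatten_cat. Qed.

Lemma sb_winv f w : hom f -> sb f (winv w) = winv (sb f w).
Proof.
move=> hf; elim: w => // l w IHw.
by rewrite winv_cons sb_cat IHw /sb /= cats0 winv_cat hf.
Qed.

Lemma sb_push f l w : hom f -> feq (sb f (push l w)) (f l ++ sb f w).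
Proof.
move=> hf; case: w => //= m w; case: eqP => // ->.
rewrite /sb /= hf catA -[X in feq X _]cat0s; apply: feq_catr.
exact/feq_sym/feq_winvr.
Qed.

Lemma sb_red f w : hom f -> feq (sb f (red w)) (sb f w).
Proof.
move=> hf; elim: w => //= l w IHw; apply: feq_trans (sb_push _ _ hf) _.
exact: feq_catl.
Qed.

Lemma sb_feq f u v : hom f -> feq u v -> feq (sb f u) (sb f v).
Proof.
move=> hf uv; apply: feq_trans (feq_sym (sb_red u hf)) _.
by rewrite uv; apply: sb_red.
Qed.

Lemma eq_sb_feq f g w : (forall l, feq (f l) (g l)) -> feq (sb f w) (sb g w).
Proof. by move=> fg; elim: w => //= l w IHw; apply: feq_cat. Qed.

Lemma size_sb f w k : (forall l, size (f l) <= k) -> size (sb f w) <= k * size w.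
Proof.
by move=> fk; elim: w => //= l w IHw; rewrite sb_cons size_cat mulnS leq_add.
Qed.

End Substitution.

Lemma sb_sb (T1 T2 T3 : eqType) (f : T2 * bool -> seq (T3 * bool))
    (g : T1 * bool -> seq (T2 * bool)) w :
  sb f (sb g w) = sb (fun l => sb f (g l)) w.
Proof. by elim: w => //= l w IHw; rewrite !sb_cons sb_cat IHw. Qed.

Lemma hom_sb (T1 T2 T3 : eqType) (f : T2 * bool -> seq (T3 * bool))
    (g : T1 * bool -> seq (T2 * bool)) :
  hom f -> hom g -> hom (fun l => sb f (g l)).
Proof. by move=> hf hg l /=; rewrite hg sb_winv. Qed.

Lemma hom_red (T1 T2 : eqType) (f : T1 * bool -> seq (T2 * bool)) :
  hom f -> hom (fun l => red (f l)).
Proof. by move=> hf l; rewrite hf red_winv. Qed.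

(** * Recursive functions of natural numbers *)

(** Lists replace tuples to avoid casts between tuple types; only the values on lists of length [k]
    count. *)
Definition recs k (f : seq nat -> nat) := recursive (fun t : k.-tuple nat => f t).

Lemma eq_recursive k (f g : k.-tuple nat -> nat) :
  f =1 g -> recursive f -> recursive g.
Proof.
move=> fg rf; apply: (rec_comp (g := fun i t => tnth t i) rf) => [i | t].
  exact: (@rec_proj k i).
rewrite -fg; congr f; apply: eq_from_tnth => i.
by rewrite tnth_mktuple.
Qed.

Lemma recs_ext k f g :
  (forall s, size s = k -> f s = g s) -> recs k f -> recs k g.
Proof. by move=> fg; apply: eq_recursive => t; apply/fg/size_tuple. Qed.

Lemma recs_nth k i : i < k -> recs k (fun s => nth 0 s i).
Proof.
move=> ik; apply: (@rec_proj k (Ordinal ik)) => t.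
by rewrite (tnth_nth 0).
Qed.

Lemma recs_comp k m f (gs : seq (seq nat -> nat)) :
  size gs = m -> recs m f -> (forall i, i < m -> recs k (nth (fun=> 0) gs i)) ->
  recs k (fun s => f [seq g s | g <- gs]).
Proof.
move=> szg rf rg.
apply: (rec_comp (g := fun i (t : k.-tuple nat) => nth (fun=> 0) gs i t) rf) => [i | t].
  exact: (rg i).
congr f; apply: (@eq_from_nth _ 0); first by rewrite size_map szg size_tuple.
move=> i; rewrite size_map szg => im.
rewrite (nth_map (fun=> 0)) ?szg //.
by rewrite -[i]/(val (Ordinal im)) -tnth_nth tnth_mktuple.
Qed.

Lemma recs_comp1 k f e :
  recs 1 (fun s => f (nth 0 s 0)) -> recs k e -> recs k (fun s => f (e s)).
Proof.
move=> rf re; apply: (@recs_comp k 1 (fun s => f (nth 0 s 0)) [:: e]) => //.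
by case.
Qed.

Lemma recs_comp2 k f e1 e2 :
  recs 2 (fun s => f (nth 0 s 0) (nth 0 s 1)) -> recs k e1 -> recs k e2 ->
  recs k (fun s => f (e1 s) (e2 s)).
Proof.
move=> rf r1 r2.
apply: (@recs_comp k 2 (fun s => f (nth 0 s 0) (nth 0 s 1)) [:: e1; e2]) => //.
by case=> [|[]].
Qed.

Lemma recs_succ k e : recs k e -> recs k (fun s => (e s).+1).
Proof.
apply: recs_comp1; apply: rec_succ => t.
by rewrite (tnth_nth 0).
Qed.

Lemma recs_const k c : recs k (fun=> c).
Proof. by elim: c => [|c IHc]; [apply: rec_zero | apply: recs_succ]. Qed.

Lemma recs_natrec k n z g :
  recs k n -> recs k z -> recs k.+2 g ->
  recs k (fun s => nat_rect (fun=> nat) (z s) (fun m r => g [:: m, r & s]) (n s)).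
Proof.
move=> rn rz rg.
pose h s := nat_rect (fun=> nat) (z (behead s))
  (fun m r => g [:: m, r & behead s]) (head 0 s).
have rh : recs k.+1 h by apply: (rec_prim rz rg).
(* The recursion argument of [h] is its first coordinate, so [h] is composed with [n] followed by
   all [k] projections, which reproduce [s]. *)
apply: (@recs_ext k (fun s => h [seq f s | f <- n :: [seq (nth 0)^~ i | i <- iota 0 k]])).
  move=> s sk; rewrite /h /=; set s' := map _ _.
  suff -> : s' = s by [].
  apply: (@eq_from_nth _ 0); first by rewrite !size_map size_iota.
  move=> i; rewrite !size_map size_iota => ik.
  by rewrite /s' -map_comp (nth_map 0) ?size_iota //= nth_iota.
apply: (@recs_comp k k.+1) rh _; first by rewrite /= size_map size_iota.
case=> //= i ik; rewrite (nth_map 0) ?size_iota // nth_iota //.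
exact: recs_nth.
Qed.

Lemma recs_min k f h : recs k.+1 f ->
  (forall s, size s = k -> f (h s :: s) = 0) ->
  (forall s i, size s = k -> i < h s -> f (i :: s) <> 0) -> recs k h.
Proof.
move=> rf f0 f1; apply: (rec_min rf) => [t | t i].
  exact/f0/size_tuple.
exact/f1/size_tuple.
Qed.

Lemma recs_add k e1 e2 : recs k e1 -> recs k e2 -> recs k (fun s => e1 s + e2 s).
Proof.
apply: recs_comp2; apply: (recs_ext _ (@recs_natrec 2 (nth 0 ^~ 1) (nth 0 ^~ 0)
  (fun s => (nth 0 s 1).+1) _ _ _)); try by [apply: recs_nth | apply/recs_succ/recs_nth].
move=> s _; elim: (nth 0 s 1) => [|n] /=; first by rewrite addn0.
by rewrite addnS => ->.
Qed.

Lemma recs_mul k e1 e2 : recs k e1 -> recs k e2 -> recs k (fun s => e1 s * e2 s).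
Proof.
apply: recs_comp2; apply: (recs_ext _ (@recs_natrec 2 (nth 0 ^~ 1) (fun=> 0)
  (fun s => nth 0 s 1 + nth 0 s 2) _ _ _)).
- move=> s _; elim: (nth 0 s 1) => [|n] /=; first by rewrite muln0.
  by rewrite mulnS addnC => ->.
- exact: recs_nth.
- exact: recs_const.
- by apply: recs_add; apply: recs_nth.
Qed.

Lemma recs_pred k e : recs k e -> recs k (fun s => (e s).-1).
Proof.
apply: (@recs_comp1 _ predn).
apply: (recs_ext _ (@recs_natrec 1 (nth 0 ^~ 0) (fun=> 0) (nth 0 ^~ 0) _ _ _)).
- by move=> s _; case: (nth 0 s 0).
- exact: recs_nth.
- exact: recs_const.
- exact: recs_nth.
Qed.

Lemma recs_sub k e1 e2 : recs k e1 -> recs k e2 -> recs k (fun s => e1 s - e2 s).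
Proof.
apply: recs_comp2; apply: (recs_ext _ (@recs_natrec 2 (nth 0 ^~ 1) (nth 0 ^~ 0)
  (fun s => (nth 0 s 1).-1) _ _ _)); try by [apply: recs_nth | apply/recs_pred/recs_nth].
move=> s _; elim: (nth 0 s 1) => [|n] /=; first by rewrite subn0.
by rewrite subnS => ->.
Qed.

Lemma recs_half k e : recs k e -> recs k (fun s => (e s)./2).
Proof.
apply: (@recs_comp1 _ half).
apply: (recs_ext _ (@recs_natrec 1 (nth 0 ^~ 0) (fun=> 0)
  (fun s => nth 0 s 0 - nth 0 s 1) _ _ _)).
- by move=> s _; elim: (nth 0 s 0) => [|n] //= ->; lia.
- exact: recs_nth.
- exact: recs_const.
- by apply: recs_sub; apply: recs_nth.
Qed.

Lemma recs_exp2 k e : recs k e -> recs k (fun s => 2 ^ e s).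
Proof.
apply: (@recs_comp1 _ (expn 2)).
apply: (recs_ext _ (@recs_natrec 1 (nth 0 ^~ 0) (fun=> 1)
  (fun s => nth 0 s 1 + nth 0 s 1) _ _ _)).
- by move=> s _; elim: (nth 0 s 0) => [|n] //= ->; rewrite expnS; lia.
- exact: recs_nth.
- exact: recs_const.
- by apply: recs_add; apply: recs_nth.
Qed.

Lemma recs_half_iter k e1 e2 :
  recs k e1 -> recs k e2 -> recs k (fun s => iter (e1 s) half (e2 s)).
Proof.
apply: (@recs_comp2 _ (fun m n => iter m half n)).
apply: (recs_ext _ (@recs_natrec 2 (nth 0 ^~ 0) (nth 0 ^~ 1)
  (fun s => (nth 0 s 1)./2) _ _ _)).
- by move=> s _; elim: (nth 0 s 0) => [|n] //= ->.
- exact: recs_nth.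
- exact: recs_nth.
- exact/recs_half/recs_nth.
Qed.

(* [CodeSeq.code (a :: s) = codecons a (CodeSeq.code s)]; the same function
   encodes pairs, with projections [codehd] and [codetl]. *)
Definition codecons a b := 2 ^ a * b.*2.+1.
Definition codehd m := logn 2 m.
Definition codetl m := (iter (codehd m) half m)./2.

Lemma iter_half i m : iter i half m = m %/ 2 ^ i.
Proof.
elim: i => [|i IHi] /=; first by rewrite divn1.
by rewrite IHi -divn2 -divnMA expnSr.
Qed.

Lemma codehdK a b : codehd (codecons a b) = a.
Proof.
rewrite /codehd /codecons lognM ?expn_gt0 // pfactorK //.
by rewrite lognE /= dvdn2 /= odd_double /= addn0.
Qed.

Lemma codetlK a b : codetl (codecons a b) = b.
Proof.
rewrite /codetl codehdK iter_half /codecons mulKn ?expn_gt0 //; lia.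
Qed.

Lemma codecons_gt0 a b : 0 < codecons a b.
Proof. by rewrite /codecons muln_gt0 expn_gt0. Qed.

Lemma recs_codecons k e1 e2 :
  recs k e1 -> recs k e2 -> recs k (fun s => codecons (e1 s) (e2 s)).
Proof.
move=> r1 r2; apply: recs_mul; first exact: recs_exp2.
apply/recs_succ; apply: (@recs_ext _ (fun s => e2 s + e2 s)).
  by move=> s _; rewrite addnn.
exact: recs_add.
Qed.

Lemma recs_codehd k e : recs k e -> recs k (fun s => codehd (e s)).
Proof.
apply: (@recs_comp1 _ codehd).
pose t (s : seq nat) := iter (nth 0 s 0) half (nth 0 s 1).
(* The 2-adic valuation of m is the least i for which m halved i times is odd; a number minus twice
   its half is its parity. The factor m makes the search stop at once for m = 0, where [logn] is
   0. *)
apply: (@recs_min _ (fun s => nth 0 s 1 * (1 - (t s - (t s)./2 - (t s)./2)))).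
- have rt : recs 2 t by apply: recs_half_iter; apply: recs_nth.
  apply: recs_mul; first exact: recs_nth.
  apply: recs_sub; first exact: recs_const.
  apply: recs_sub; last exact: recs_half.
  by apply: recs_sub => //; exact: recs_half.
- case=> // m [|] //= _; rewrite /t /= iter_half /codehd.
  case: (posnP m) => [-> // | m_gt0].
  have odq : odd (m %/ 2 ^ logn 2 m).
    have /(@dvdnP _ _)[q mE] := pfactor_dvdnn 2 m.
    rewrite {1}mE mulnK ?expn_gt0 //; apply/negPn/negP; rewrite -dvdn2 => dq.
    have : 2 ^ (logn 2 m).+1 %| m by rewrite expnS {2}mE dvdn_mul.
    by rewrite pfactor_dvdn // ltnn.
  by apply/eqP; rewrite muln_eq0; apply/orP; right; lia.
- case=> // m [|] //= i _; rewrite /t /= iter_half /codehd => im.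
  have m_gt0 : 0 < m by case: m im; rewrite // logn0.
  have : 2 ^ i.+1 %| m by rewrite pfactor_dvdn.
  move=> /dvdnP[q mE]; rewrite {2 3 4}mE expnSr mulnA mulnAC mulnK ?expn_gt0 //.
  by apply/eqP; rewrite muln_eq0; lia.
Qed.

Lemma recs_codetl k e : recs k e -> recs k (fun s => codetl (e s)).
Proof.
by move=> re; apply/recs_half/recs_half_iter => //; apply: recs_codehd.
Qed.

Lemma recs_if k (b : seq nat -> bool) e1 e2 :
  recs k (fun s => b s) -> recs k e1 -> recs k e2 ->
  recs k (fun s => if b s then e1 s else e2 s).
Proof.
move=> rb r1 r2.
apply: (@recs_ext _ (fun s => b s * e1 s + (1 - b s) * e2 s)).
  by move=> s _; case: (b s); lia.
apply: recs_add; apply: recs_mul => //.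
by apply: recs_sub => //; apply: recs_const.
Qed.

Lemma recs_eqn k e1 e2 : recs k e1 -> recs k e2 -> recs k (fun s => e1 s == e2 s).
Proof.
move=> r1 r2.
apply: (@recs_ext _ (fun s => 1 - ((e1 s - e2 s) + (e2 s - e1 s)))).
  by move=> s _; case: eqP; lia.
apply: recs_sub; first exact: recs_const.
by apply: recs_add; apply: recs_sub.
Qed.

(** * Computable functions between encoded types *)

Class Enc (T : Type) := en : T -> nat.

#[global] Instance enc_nat : Enc nat := id.
#[global] Instance enc_bool : Enc bool := nat_of_bool.
#[global] Instance enc_prod A B (_ : Enc A) (_ : Enc B) : Enc (A * B) | 10 :=
  fun p => codecons (en p.1) (en p.2).
#[global] Instance enc_seq A (_ : Enc A) : Enc (seq A) :=
  fun s => CodeSeq.code (map en s).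
(** Letters are also pairs; the priority lets [letter_code] win over the pair code, so that [en] on
    words is the [word_code] of the statement. *)
#[global] Instance enc_letter n : Enc ('I_n * bool) | 0 := @letter_code n.

(** [g] is arbitrary on numbers that are not codes, so malformed inputs never have to be
    recognized. *)
Definition computable A B {eA : Enc A} {eB : Enc B} (f : A -> B) : Prop :=
  exists2 g : nat -> nat, recs 1 (fun s => g (nth 0 s 0)) & forall x, g (en x) = en (f x).

Section Closure.
Context {A B C : Type} {eA : Enc A} {eB : Enc B} {eC : Enc C}.

Lemma computable_ext (f g : A -> B) : f =1 g -> computable f -> computable g.
Proof. by move=> fg [h rh hf]; exists h => // x; rewrite hf fg. Qed.

Lemma computable_const (b : B) : computable (fun _ : A => b).
Proof. by exists (fun=> en b) => //; apply: recs_const. Qed.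

Lemma computable_id : computable (fun x : A => x).
Proof. by exists id => //; apply: recs_nth. Qed.

Lemma computable_comp (f : B -> C) (g : A -> B) :
  computable f -> computable g -> computable (fun x => f (g x)).
Proof.
move=> [f' rf hf] [g' rg hg]; exists (fun c => f' (g' c)).
  exact: (recs_comp1 rf rg).
by move=> x; rewrite hg hf.
Qed.

Lemma computable_pair (f : A -> B) (g : A -> C) :
  computable f -> computable g -> computable (fun x => (f x, g x)).
Proof.
move=> [f' rf hf] [g' rg hg]; exists (fun c => codecons (f' c) (g' c)).
  exact: recs_codecons.
by move=> x; rewrite hf hg.
Qed.

Lemma computable_fst (f : A -> B * C) : computable f -> computable (fun x => (f x).1).
Proof.
move=> [f' rf hf]; exists (fun c => codehd (f' c)); first exact: recs_codehd.
by move=> x; rewrite hf codehdK.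
Qed.

Lemma computable_snd (f : A -> B * C) : computable f -> computable (fun x => (f x).2).
Proof.
move=> [f' rf hf]; exists (fun c => codetl (f' c)); first exact: recs_codetl.
by move=> x; rewrite hf codetlK.
Qed.

Lemma computable_cons (f : A -> B) (g : A -> seq B) :
  computable f -> computable g -> computable (fun x => f x :: g x).
Proof.
move=> [f' rf hf] [g' rg hg]; exists (fun c => codecons (f' c) (g' c)).
  exact: recs_codecons.
by move=> x; rewrite hf hg.
Qed.

Lemma computable_if (b : A -> bool) (f g : A -> B) :
  computable b -> computable f -> computable g ->
  computable (fun x => if b x then f x else g x).
Proof.
move=> [b' rb hb] [f' rf hf] [g' rg hg].
exists (fun c => if b' c == 1 then f' c else g' c).
  by apply: recs_if => //; apply: recs_eqn => //; apply: recs_const.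
by move=> x; rewrite hb hf hg; case: (b x).
Qed.

Lemma computable_eq (f g : A -> B) (eqB : rel B) :
  (forall x y, eqB x y = (en x == en y)) ->
  computable f -> computable g -> computable (fun x => eqB (f x) (g x)).
Proof.
move=> eqBE [f' rf hf] [g' rg hg]; exists (fun c => f' c == g' c : nat).
  exact: recs_eqn.
by move=> x; rewrite hf hg eqBE.
Qed.

Lemma computable_nat2 (op : nat -> nat -> nat) (f g : A -> nat) :
  (forall e1 e2, recs 1 e1 -> recs 1 e2 -> recs 1 (fun s => op (e1 s) (e2 s))) ->
  computable f -> computable g -> computable (fun x => op (f x) (g x)).
Proof.
move=> rop [f' rf hf] [g' rg hg]; exists (fun c => op (f' c) (g' c)).
  exact: rop.
by move=> x; rewrite hf hg.
Qed.

Lemma computable_en (f : A -> B) : computable f -> computable (fun x => en (f x)).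
Proof. by move=> [f' rf hf]; exists f'. Qed.

End Closure.

Section Recursion.
Context {A B C : Type} {eA : Enc A} {eB : Enc B} {eC : Enc C}.

Lemma computable_natrec (n : A -> nat) (z : A -> B) (g : A * (nat * B) -> B) :
  computable n -> computable z -> computable g ->
  computable (fun x => nat_rect (fun=> B) (z x) (fun m r => g (x, (m, r))) (n x)).
Proof.
move=> [n' rn hn] [z' rz hz] [g' rg hg].
exists (fun c => nat_rect (fun=> nat) (z' c)
    (fun m r => g' (codecons c (codecons m r))) (n' c)).
  apply: (@recs_natrec 1 (fun s => n' (nth 0 s 0)) (fun s => z' (nth 0 s 0))
    (fun s => g' (codecons (nth 0 s 2) (codecons (nth 0 s 0) (nth 0 s 1))))) => //.
  apply: (recs_comp1 rg); apply: recs_codecons; first exact: recs_nth.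
  by apply: recs_codecons; apply: recs_nth.
move=> x; rewrite hn; change (en (n x)) with (n x).
by elim: (n x) => [|m IHm] //=; rewrite IHm -hg.
Qed.

Lemma computable_case (l : A -> seq B) (f : A -> C) (g : A * (B * seq B) -> C) :
  computable l -> computable f -> computable g ->
  computable (fun x => if l x is t :: r then g (x, (t, r)) else f x).
Proof.
move=> [l' rl hl] [f' rf hf] [g' rg hg].
(* A nonempty list has a positive code, which is at the same time the code of the pair of its head
   and tail. *)
exists (fun c => if l' c == 0 then f' c else g' (codecons c (l' c))).
  apply: recs_if => //; first by apply: recs_eqn => //; apply: recs_const.
  by apply: (recs_comp1 rg); apply: recs_codecons => //; apply: recs_nth.
move=> x; rewrite hl; case: (l x) => [|t r]; first by rewrite /= hf.
by rewrite -hg [en (t :: r) == 0]eqn0Ngt codecons_gt0.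
Qed.

End Recursion.

Section ListRecursion.
Context {A B C : Type} {eA : Enc A} {eB : Enc B} {eC : Enc C}.

(** Lets the code of a list serve as the number of iterations of a loop over that list. *)
Lemma size_le_code (s : seq B) : size s <= en s.
Proof.
elim: s => // t s IHs; apply: leq_ltn_trans IHs _.
change (en (t :: s)) with (codecons (en t) (en s)); rewrite /codecons.
have : 0 < 2 ^ en t by rewrite expn_gt0.
by move: (2 ^ en t) (en s) => a b; nia.
Qed.

(** A machine with state (remaining list, accumulator) is iterated as often as the code of the list
    says; once the remaining list is empty the surplus steps do nothing. *)
Lemma computable_foldl (s : A -> seq B) (z : A -> C) (g : A * (B * C) -> C) :
  computable s -> computable z -> computable g ->
  computable (fun x => foldl (fun a t => g (x, (t, a))) (z x) (s x)).
Proof.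
move=> cs cz cg.
pose step (p : A * (nat * (seq B * C))) :=
  let: st := p.2.2 in
  if st.1 is t :: r then (r, g (p.1, (t, st.2))) else st.
have cstep : computable step.
  have cst : computable (fun p : A * (nat * (seq B * C)) => p.2.2).
    by do 2!apply: computable_snd; apply: computable_id.
  apply: (computable_case (f := fun p => p.2.2)
    (g := fun q => (q.2.2, g (q.1.1, (q.2.1, q.1.2.2.2))))) => //.
    exact: computable_fst.
  pose D := ((A * (nat * (seq B * C))) * (B * seq B))%type.
  have c1 : computable (fun q : D => q.2) by apply: computable_snd; apply: computable_id.
  have c2 : computable (fun q : D => q.1) by apply: computable_fst; apply: computable_id.
  apply: computable_pair; first exact: computable_snd.
  apply: (computable_comp cg); apply: computable_pair; first exact: computable_fst.
  apply: computable_pair; first exact: computable_fst.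
  by do 3!apply: computable_snd.
have := computable_natrec (computable_en cs) (computable_pair cs cz) cstep.
move=> /computable_snd; apply: computable_ext => x.
suff E m : forall (r : seq B) c, size r <= m ->
    nat_rect (fun=> (seq B * C)%type) (r, c) (fun m' q => step (x, (m', q))) m
    = ([::], foldl (fun a t => g (x, (t, a))) c r).
  by rewrite E //; apply: size_le_code.
have nat_rectS (st : seq B * C) k :
    nat_rect (fun=> (seq B * C)%type) st (fun m' q => step (x, (m', q))) k.+1 =
    nat_rect (fun=> (seq B * C)%type) (step (x, (0, st))) (fun m' q => step (x, (m', q))) k.
  by elim: k => //= k ->.
elim: m => [[] // | m IHm] r c rm; rewrite nat_rectS.
by case: r rm => [|t r] rm; rewrite /step /= IHm.
Qed.

End ListRecursion.

Lemma computable_rev {A B : Type} {eA : Enc A} {eB : Enc B} (s : A -> seq B) :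
  computable s -> computable (fun x => rev (s x)).
Proof.
move=> cs; have cg : computable (fun p : A * (B * seq B) => p.2.1 :: p.2.2).
  apply: computable_cons; last by do 2!apply: computable_snd; apply: computable_id.
  by apply: computable_fst; apply: computable_snd; apply: computable_id.
have := computable_foldl cs (computable_const [::]) cg.
apply: computable_ext => x /=; rewrite -[rev _]cats0; move: [::].
by elim: (s x) => [|t r IHr] a //=; rewrite IHr rev_cons cat_rcons.
Qed.

Lemma computable_foldr {A B C : Type} {eA : Enc A} {eB : Enc B} {eC : Enc C}
    (s : A -> seq B) (z : A -> C) (g : A * (B * C) -> C) :
  computable s -> computable z -> computable g ->
  computable (fun x => foldr (fun t a => g (x, (t, a))) (z x) (s x)).
Proof.
move=> cs cz cg; have := computable_foldl (computable_rev cs) cz cg.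
by apply: computable_ext => x; rewrite foldl_rev.
Qed.

Section Lists.
Context {A B C : Type} {eA : Enc A} {eB : Enc B} {eC : Enc C}.

Lemma computable_map (s : A -> seq B) (g : A * B -> C) :
  computable s -> computable g -> computable (fun x => [seq g (x, t) | t <- s x]).
Proof.
move=> cs cg.
have cg' : computable (fun p : A * (B * seq C) => g (p.1, p.2.1) :: p.2.2).
  apply: computable_cons; last by do 2!apply: computable_snd; apply: computable_id.
  apply: (computable_comp cg); apply: computable_pair.
    by apply: computable_fst; apply: computable_id.
  by apply: computable_fst; apply: computable_snd; apply: computable_id.
have := computable_foldr cs (computable_const [::]) cg'.
by apply: computable_ext => x; elim: (s x) => //= t r ->.
Qed.

Lemma computable_has (s : A -> seq B) (g : A * B -> bool) :
  computable s -> computable g -> computable (fun x => has (fun t => g (x, t)) (s x)).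
Proof.
move=> cs cg.
have cg' : computable (fun p : A * (B * bool) => if g (p.1, p.2.1) then true else p.2.2).
  apply: computable_if; last by do 2!apply: computable_snd; apply: computable_id.
    apply: (computable_comp cg); apply: computable_pair.
      by apply: computable_fst; apply: computable_id.
    by apply: computable_fst; apply: computable_snd; apply: computable_id.
  exact: computable_const.
have := computable_foldr cs (computable_const false) cg'.
by apply: computable_ext => x; elim: (s x) => //= t r ->; case: (g _).
Qed.

Lemma computable_cat (s t : A -> seq B) :
  computable s -> computable t -> computable (fun x => s x ++ t x).
Proof.
move=> cs ct.
have cg : computable (fun p : A * (B * seq B) => p.2.1 :: p.2.2).
  apply: computable_cons; last by do 2!apply: computable_snd; apply: computable_id.
  by apply: computable_fst; apply: computable_snd; apply: computable_id.
have := computable_foldr cs ct cg.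
by apply: computable_ext => x; elim: (s x) => //= a r ->.
Qed.

Lemma computable_size (s : A -> seq B) : computable s -> computable (fun x => size (s x)).
Proof.
move=> cs; have cg : computable (fun p : A * (B * nat) => p.2.2 + 1).
  apply: (computable_nat2 (@recs_add 1)); last exact: computable_const.
  by do 2!apply: computable_snd; apply: computable_id.
have := computable_foldr cs (computable_const 0) cg.
by apply: computable_ext => x; elim: (s x) => //= a r ->; rewrite addn1.
Qed.

Lemma computable_iter (n : A -> nat) (z : A -> B) (g : A * B -> B) :
  computable n -> computable z -> computable g ->
  computable (fun x => iter (n x) (fun b => g (x, b)) (z x)).
Proof.
move=> cn cz cg; have cg' : computable (fun p : A * (nat * B) => g (p.1, p.2.2)).
  apply: (computable_comp cg); apply: computable_pair.
    by apply: computable_fst; apply: computable_id.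
  by do 2!apply: computable_snd; apply: computable_id.
have := computable_natrec cn cz cg'.
by apply: computable_ext => x; elim: (n x) => //= m ->.
Qed.

Lemma computable_and (b c : A -> bool) :
  computable b -> computable c -> computable (fun x => b x && c x).
Proof.
move=> cb cc; have := computable_if cb cc (computable_const false).
by apply: computable_ext => x; case: (b x).
Qed.

Lemma computable_leq (f g : A -> nat) :
  computable f -> computable g -> computable (fun x => f x <= g x).
Proof.
move=> cf cg; have := computable_nat2 (@recs_sub 1) cf cg.
move=> /(computable_eq (eqB := fun m n : nat => m == n) (fun _ _ => erefl)).
by move=> /(_ _ (computable_const 0)); apply: computable_ext => x.
Qed.

Lemma computable_all_in (D : eqType) (s : seq D) (b : D -> A -> bool) :
  (forall d, d \in s -> computable (b d)) -> computable (fun x => all (fun d => b d x) s).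
Proof.
elim: s => [|d s IHs] cb; first exact: computable_const.
apply: computable_and; first by apply: cb; rewrite mem_head.
by apply: IHs => e es; apply: cb; rewrite inE es orbT.
Qed.

Lemma computable_map_in (D : Type) (s : seq D) (f : D -> A -> B) :
  (forall d, computable (f d)) -> computable (fun x => [seq f d x | d <- s]).
Proof.
move=> cf; elim: s => [|d s IHs]; first exact: computable_const.
exact: computable_cons.
Qed.

Lemma computable_switch (D : finType) {eD : Enc D} (l : A -> D) (f : D -> A -> B) :
  injective (@en D eD) -> computable l -> (forall d, computable (f d)) ->
  computable (fun x => f (l x) x).
Proof.
move=> inj_en cl cf.
(* [B] has no default value, so the fallback branch is itself a value of [f]. *)
have H (s : seq D) : forall d0, computable (fun x => if l x \in d0 :: s then f (l x) x else f d0 x).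
  elim: s => [|d s IHs] d0.
    apply: computable_ext (cf d0) => x; rewrite mem_seq1.
    by case: eqP => // ->.
  have := computable_if (computable_eq (eqB := fun a b : D => a == b) _ cl
    (computable_const d)) (cf d) (IHs d0).
  move=> /(_ (fun a b => esym (inj_eq inj_en a b))); apply: computable_ext => x.
  rewrite !inE; case: (l x =P d) => [-> | _] /=; last by [].
  by rewrite orbT.
case: (pickP (xpredT : pred D)) => [d0 _ | D0].
  apply: computable_ext (H (enum D) d0) => x.
  by rewrite inE mem_enum inE orbT.
(* With [D] empty, [l] shows that [A] is empty too. *)
by exists id => [|x]; [exact: recs_nth | have := D0 (l x)].
Qed.

End Lists.

Lemma computable_flatten {A B} {eA : Enc A} {eB : Enc B} (s : A -> seq (seq B)) :
  computable s -> computable (fun x => flatten (s x)).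
Proof.
move=> cs; have cg : computable (fun p : A * (seq B * seq B) => p.2.1 ++ p.2.2).
  apply: computable_cat; last by do 2!apply: computable_snd; apply: computable_id.
  by apply: computable_fst; apply: computable_snd; apply: computable_id.
exact: (computable_foldr cs (computable_const [::]) cg).
Qed.

Lemma letter_code_inj n : injective (@letter_code n).
Proof.
move=> [i b] [j c] /=; rewrite /letter_code /= => e.
have ij : i = j :> nat by case: b c e => [] []; lia.
by rewrite (ord_inj ij) in e *; congr pair; case: b c e => [] []; lia.
Qed.

Lemma word_en_eq n (u v : seq ('I_n * bool)) : (u == v) = (en u == en v).
Proof.
apply/eqP/eqP => [-> // | /(can_inj CodeSeq.codeK)].
exact/inj_map/letter_code_inj.
Qed.

Lemma computable_pred2 n (P : word n -> word n -> Prop) (d : word n -> word n -> bool) :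
  computable (fun p : seq ('I_n * bool) * seq ('I_n * bool) => d p.1 p.2) ->
  (forall u v, d u v <-> P u v) -> algorithmically_decidable P.
Proof.
move=> [g rg hg] dP.
exists d, (fun t => g (codecons (nth 0 t 0) (nth 0 t 1))); split=> //.
  change (recs 2 (fun s => g (codecons (nth 0 s 0) (nth 0 s 1)))).
  by apply: (recs_comp1 rg); apply: recs_codecons; apply: recs_nth.
by move=> u v; apply: (hg (u, v)).
Qed.

(** * Whitehead moves *)

Section Graphs.
Variables (V E : eqType) (o : E * bool -> V).

(* [o l] is the origin of the oriented edge [l], so that its end is [o (linv l)] *)
Fixpoint gpath v w v' :=
  if w is l :: w' then (o l == v) && gpath (o (linv l)) w' v' else v == v'.

Lemma gpath_cat u v w s t : gpath u s v -> gpath v t w -> gpath u (s ++ t) w.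
Proof.
elim: s u => [|l s IHs] u /=; first by move/eqP->.
by case/andP=> -> /= sv tw; apply: IHs.
Qed.

End Graphs.

Lemma gpath_map (V V' E : eqType) (h : V -> V') (o : E * bool -> V) u w v :
  gpath o u w v -> gpath (h \o o) (h u) w (h v).
Proof.
elim: w u => [|l w IHw] u /=; first by move/eqP->.
by case/andP=> /eqP-> /IHw ->; rewrite eqxx.
Qed.

Section PartialLabels.
Variables (E T : eqType).
Implicit Types (k : E * bool -> option (T * bool)).

Definition lsym k := forall l, k (linv l) = omap (@linv T) (k l).
Definition linj k := forall l l' m, k l = Some m -> k l' = Some m -> l = l'.

Definition lb k l : seq (T * bool) := if k l is Some m then [:: m] else [::].

Lemma hom_lb k : lsym k -> hom (lb k).
Proof. by move=> sk l; rewrite /lb sk; case: (k l). Qed.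

(** [None] marks a contracted edge: exactly [a] is contracted, and the surviving edges are read as
    letters. The freedom in naming them absorbs the signed permutations of the basis. *)
Definition lab k (a : E) :=
  [/\ lsym k, forall l, (k l == None) = (l.1 == a) & linj k].

Lemma lb_None k l : k l = None -> lb k l = [::].
Proof. by rewrite /lb => ->. Qed.

Lemma lb_Some k l m : k l = Some m -> lb k l = [:: m].
Proof. by rewrite /lb => ->. Qed.

Lemma size_sb_lb k w : size (sb (lb k) w) = count (fun l => k l != None) w.
Proof.
by elim: w => //= l w IHw; rewrite sb_cons size_cat IHw /lb; case: (k l).
Qed.

(* Killing an edge that is not a loop cannot create a cancellation in a path:
   the two neighbours of a killed edge have different end points. *)
Lemma contract_reduced (V : eqType) (o : E * bool -> V) k a u v w :
  lab k a -> o (a, false) != o (a, true) ->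
  reduced w -> gpath o u w v -> reduced (sb (lb k) w).
Proof.
move=> [sk ka ik] oa; have oa' l : l.1 = a -> o l != o (linv l).
  by case: l => i [] /= ->; rewrite /linv //= eq_sym.
have Knone l : k l = None -> l.1 = a by move/eqP; rewrite ka => /eqP.
elim: w u => [|l w IHw] u // rw /= /andP[_ pw].
have {}IHw : reduced (sb (lb k) w).
  by apply: IHw pw; move: rw; rewrite reduced_cons => /andP[].
rewrite sb_cons; case kl: (k l) => [m|]; last by rewrite (lb_None kl).
rewrite (lb_Some kl) cat1s reduced_cons IHw andbT.
have hinv l' m' : k l' = Some m' -> m' = linv m -> l' = linv l.
  by move=> kl' em; apply: ik kl' _; rewrite sk kl em.
case: w rw pw {IHw} => [|l2 w] // /andP[ne1 rw] /= /andP[/eqP o1 pw].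
rewrite sb_cons; case k2: (k l2) => [m2|].
  rewrite (lb_Some k2) /=; apply: contra ne1 => /eqP em.
  by rewrite (hinv _ _ k2 em).
rewrite (lb_None k2) cat0s; case: w rw pw => [|l3 w] //= /andP[ne2 rw] /andP[/eqP o2 pw].
have a2 := Knone _ k2; rewrite sb_cons; case k3: (k l3) => [m3|].
  rewrite (lb_Some k3) /=; apply: contra (oa' _ a2) => /eqP em.
  by rewrite -o2 (hinv _ _ k3 em) o1.
have a3 := Knone _ k3; have [e|e] : l3 = l2 \/ l3 = linv l2.
- by apply: letter_same; rewrite a2 a3.
- by move: (oa' _ a2); rewrite -o2 e eqxx.
- by rewrite e eqxx in ne2.
Qed.

End PartialLabels.

(** * Blown-up roses and Whitehead moves *)

Section Turns.
Variable T : eqType.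
Implicit Types (u : seq (T * bool)) (d : option (T * bool)).

(* The reduced word [u] is seen as a closed path in the rose; [None] stands for
   its base point, and a turn is a pair of consecutive directions. *)
Fixpoint turns d u :=
  if u is l :: u' then (d, Some l) :: turns (Some (linv l)) u' else [:: (d, None)].

Section Blow.
Variable Y : Type.
Implicit Types (f : option (T * bool) -> option (T * bool) -> seq Y).

(** The common form of the blow-ups along one and two cuts: [f] is inserted at every turn, including
    those at the base point, and [g] at every letter. *)
Fixpoint blowg f (g : T * bool -> seq Y) d u :=
  if u is l :: u' then f d (Some l) ++ g l ++ blowg f g (Some (linv l)) u'
  else f d None.

Lemma eq_blowg f f' g g' d u : (forall d d', f d d' = f' d d') -> g =1 g' ->
  blowg f g d u = blowg f' g' d u.
Proof. by move=> ff gg; elim: u d => [|l u IHu] d /=; rewrite ?IHu ff ?gg. Qed.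

Lemma count_blowg p f g d u : count p (blowg f g d u) =
  sumn [seq count p (f t.1 t.2) | t <- turns d u] + sumn [seq count p (g l) | l <- u].
Proof.
elim: u d => [|l u IHu] d /=; first by rewrite !addn0.
rewrite !count_cat IHu; lia.
Qed.

End Blow.

Lemma sb_blowg (T1 T2 : eqType) (h : T1 * bool -> seq (T2 * bool)) f g d u :
  sb h (blowg f g d u) = blowg (fun d d' => sb h (f d d')) (fun l => sb h (g l)) d u.
Proof. by elim: u d => //= l u IHu d; rewrite !sb_cat IHu. Qed.

Definition cuts (A : pred (option (T * bool))) u :=
  count (fun t => A t.1 != A t.2) (turns None u).

Definition occ (a : T) u := count (fun l : T * bool => l.1 == a) u.

Definition corner (A B : pred (option (T * bool))) (x y : bool) d :=
  (A d == x) && (B d == y).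

(** Submodularity holds for each single turn, by inspection of the sides of [A] and [B] on which its
    two directions lie. *)
Lemma cuts_corner A B x y u :
  cuts (corner A B x y) u + cuts (corner A B (~~ x) (~~ y)) u <= cuts A u + cuts B u.
Proof.
rewrite /cuts /corner; elim: (turns _ _) => //= t s IHs.
by case: (A t.1) (A t.2) (B t.1) (B t.2) x y IHs => [] [] [] [] [] []; rewrite /=; lia.
Qed.

Definition emb (l : T * bool) : seq (option T * bool) := [:: (Some l.1, l.2)].

Definition turn (A : pred (option (T * bool))) d d' : seq (option T * bool) :=
  if A d == A d' then [::] else [:: (None, A d)].

(* The rose is blown up by splitting its vertex along the cut [A]; the new edge
   [None] leads from the complement of [A] to [A]. *)
Definition blow A u := blowg (turn A) emb None u.

Definition orig (A : pred (option (T * bool))) (l : option T * bool) :=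
  if l.1 is Some i then A (Some (i, l.2)) else l.2.

Lemma orig_emb A l : orig A (Some l.1, l.2) = A (Some l).
Proof. by rewrite /orig /= -surjective_pairing. Qed.

Lemma gpath_blow A u : gpath (orig A) (A None) (blow A u) (A None).
Proof.
rewrite /blow; have pt d d' : gpath (orig A) (A d) (turn A d d') (A d').
  rewrite /turn; case: eqP => [-> | /eqP ne] /=; first exact: eqxx.
  by rewrite /orig /linv /= eqxx /=; case: (A d) ne; case: (A d').
suff H d : gpath (orig A) (A d) (blowg (turn A) emb d u) (A None) by apply: H.
elim: u d => [|l u IHu] d /=; first exact: pt.
apply: gpath_cat (pt _ _) _; rewrite /= orig_emb eqxx /=.
by rewrite (orig_emb A (linv l)); apply: IHu.
Qed.

(** Two new edges are always separated by a letter of [u], and letters that stay adjacent were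
    adjacent in [u]. *)
Lemma reduced_blow A u : reduced u -> reduced (blow A u).
Proof.
have H l0 v : reduced (l0 :: v) ->
    reduced ((Some l0.1, l0.2) :: blowg (turn A) emb (Some (linv l0)) v).
  elim: v l0 => [|l v IHv] l0.
    by rewrite /= /turn; case: ifP.
  rewrite reduced_cons => /andP[ne rv]; move/IHv: (rv) => {}IHv /=.
  rewrite /turn; case: ifP => _; last first.
    by rewrite /= -[path _ _ _]/(reduced (_ :: _)) IHv.
  rewrite cat0s /= -[path _ _ _]/(reduced (_ :: _)) IHv andbT.
  by apply: contra ne => /eqP[e1 e2]; apply/eqP; rewrite /linv -e1 -e2 -surjective_pairing.
rewrite /blow; case: u => [|l u] ru /=; first by rewrite /turn eqxx.
rewrite /turn; case: ifP => _; first exact: H.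
by rewrite /= -[path _ _ _]/(reduced (_ :: _)) H.
Qed.

Lemma size_blow A u : size (blow A u) = size u + cuts A u.
Proof.
rewrite -count_predT count_blowg addnC; congr (_ + _).
  by elim: u => //= l u ->.
rewrite /cuts; elim: (turns _ _) => //= t s ->.
by rewrite /turn; case: eqP.
Qed.

Lemma count_Some_blow A a u : count (fun l => l.1 == Some a) (blow A u) = occ a u.
Proof.
rewrite count_blowg -[occ a u]add0n; congr (_ + _).
  by elim: (turns _ _) => //= t s ->; rewrite /turn; case: eqP.
by elim: u => //= l u ->; rewrite addn0.
Qed.

(** The condition on [a] says that its two ends lie on different sides of the cut: it is not a loop
    of the blown-up rose, hence a spanning tree that may be contracted instead of the new edge. *)
Definition nf u u1 A a (k : option T * bool -> option (T * bool)) :=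
  [/\ lab k (Some a), A (Some (a, false)) != A (Some (a, true)) &
      u1 = red (sb (lb k) (blow A u))].

(* [move u u1] says that [u1] is the image of [u] under a Whitehead automorphism,
   up to signed permutations of the letters. *)
Definition move u u1 := exists A a k, nf u u1 A a k.

(** Contracting a non-loop creates no cancellation, so lengths can be counted exactly: the blow-up
    adds one edge per cut turn and the contraction removes the occurrences of [a]. Sums avoid
    truncated subtraction. *)
Lemma nf_size u u1 A a k : reduced u -> nf u u1 A a k ->
  size u1 + occ a u = size u + cuts A u.
Proof.
move=> ru [kl Aa ->].
rewrite red_id; last first.
  by apply: (contract_reduced kl Aa) (gpath_blow A u); apply: reduced_blow.
case: kl => _ ka _; rewrite size_sb_lb -size_blow -(count_Some_blow A) addnC.
rewrite -(count_predC (fun l : option T * bool => l.1 == Some a)); congr (_ + _).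
by apply: eq_count => l /=; rewrite ka.
Qed.

(** Passing to the complement reverses the new edge, which [fl] undoes in the labelling. *)
Lemma nf_compl u u1 A a k : nf u u1 A a k ->
  exists k', nf u u1 (predC A) a k'.
Proof.
move=> [[sk ka ik] Aa ->].
pose fl (l : option T * bool) := if l.1 is Some _ then l else linv l.
have flK : involutive fl by case=> [[i|] b] //; rewrite /fl /linv /= negbK.
exists (fun l => k (fl l)); split.
- split.
  + by move=> [[i|] b]; rewrite -sk.
  + by move=> [[i|] b]; rewrite ka.
  + by move=> l l' m /ik h /h /(inv_inj flK).
- by rewrite /=; case: (A _) Aa; case: (A _).
- congr red; rewrite /blow !sb_blowg; apply: eq_blowg => //.
  move=> d d'; rewrite /turn /= (inj_eq negb_inj); case: ifP => // _.
  by rewrite /sb /= /lb /fl /linv /= negbK.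
Qed.

End Turns.

Section Potential.
Variable T : eqType.
Implicit Types (u : seq (T * bool)) (A : pred (option (T * bool))).

Definition pw (b : bool) : seq (option T * bool) := if b then [:: (None, false)] else [::].

(** [pw b] is the path from the vertex [false] to the vertex [b]. Each letter thus becomes a closed
    path at [false], which turns the geometric blow-up into a substitution up to conjugation. *)
Definition lam A (l : T * bool) :=
  pw (A (Some l)) ++ emb l ++ winv (pw (A (Some (linv l)))).

Lemma hom_lam A : hom (lam A).
Proof. by move=> l; rewrite /lam !winv_cat winvK linvK -catA. Qed.

Lemma turn_pw A d d' : feq (turn A d d') (winv (pw (A d)) ++ pw (A d')).
Proof. by rewrite /turn; case: (A d) (A d') => [] []. Qed.

Lemma blow_lam A u :
  feq (blow A u) (winv (pw (A None)) ++ sb (lam A) u ++ pw (A None)).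
Proof.
suff H d : feq (blowg (turn A) (@emb T) d u)
    (winv (pw (A d)) ++ sb (lam A) u ++ pw (A None)) by apply: H.
elim: u d => [|l u IHu] d; first exact: turn_pw.
rewrite sb_cons.
change (blowg (turn A) (@emb T) d (l :: u)) with
  (turn A d (Some l) ++ emb l ++ blowg (turn A) (@emb T) (Some (linv l)) u).
apply: (@feq_trans _ _ ((winv (pw (A d)) ++ pw (A (Some l))) ++
   emb l ++ (winv (pw (A (Some (linv l)))) ++ sb (lam A) u ++ pw (A None)))).
  by apply: feq_cat (turn_pw _ _ _) _; apply: feq_catl.
by rewrite /lam -!catA.
Qed.

End Potential.

(** * Exchanging one edge of a spanning tree is a Whitehead move *)

Section ChangeOfTree.
Variable T : finType.
Implicit Types (u : seq (T * bool)).

(** Renaming [a] to [None] embeds the letters into the edges that survive; following this by [k]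
    gives an injective self-map of a finite set, hence a surjection. *)
Lemma lab_surj (k : option T * bool -> option (T * bool)) a m :
  lab k a -> exists l, k l = Some m.
Proof.
move=> [sk ka ik].
pose iota (l : T * bool) : option T * bool :=
  (if Some l.1 == a then None else Some l.1, l.2).
have inj_iota : injective iota.
  move=> [i b] [j c]; rewrite /iota /= => -[].
  case: (Some i =P a) => ei; case: (Some j =P a) => ej //; last by move=> [->] ->.
  by move: ei; rewrite -ej => -[->] _ ->.
have iotaN l : k (iota l) != None.
  by rewrite ka /iota /=; case: (Some l.1 =P a) => [<- | /eqP].
pose h l := odflt m (k (iota l)).
have inj_h : injective h.
  move=> l l'; rewrite /h; have := iotaN l; have := iotaN l'.
  case el: (k (iota l)) => [n|] //; case el': (k (iota l')) => [n'|] //= _ _ e.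
  by rewrite e in el; apply: inj_iota (ik _ _ _ el el').
have /codomP[l em] : m \in codom h by apply: injF_onto.
exists (iota l); move: (iotaN l) em; rewrite /h.
by case: (k _) => //= n _ ->.
Qed.

(* Two contractions of the same closed path along spanning trees that differ by
   exchanging the edge [p] for the edge [q]. *)
Lemma move_exchange (E : eqType) (o : E * bool -> bool) v0 w p q
    (k1 k2 : E * bool -> option (T * bool)) :
  gpath o v0 w v0 ->
  lsym k1 -> lsym k2 -> linj k1 -> linj k2 ->
  (forall m, exists l, k1 l = Some m) ->
  o (p, false) != o (p, true) -> o (q, false) != o (q, true) ->
  k1 (p, false) = None -> k2 (p, false) <> None ->
  k2 (q, false) = None -> k1 (q, false) <> None ->
  (forall l, k1 l = None -> l.1 <> p -> o l = o (linv l) /\ k2 l = None) ->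
  (forall l, k2 l = None -> l.1 <> q -> k1 l = None) ->
  move (red (sb (lb k1) w)) (red (sb (lb k2) w)).
Proof.
move=> pw0 s1 s2 i1 i2 surj1 op oq k1p k2p k2q k1q dead1 dead2.
have symN (k : E * bool -> option (T * bool)) e b : lsym k ->
    (k (e, b) == None) = (k (e, false) == None).
  move=> sk; case: b => //; rewrite -[(e, true)]/(linv (e, false)) sk.
  by case: (k _).
have /fin_all_exists[j k1j] : forall m, exists l, k1 l = Some m by [].
have jk1 l m : k1 l = Some m -> j m = l by move=> e; apply: i1 (k1j m) e.
have jV m : j (linv m) = linv (j m) by apply: jk1; rewrite s1 k1j.
have jN m : (j m).1 <> p.
  have := k1j m; case: (j m) => x b /= kx ex.
  by have := symN k1 p b s1; rewrite -{1}ex kx k1p.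
(* A direction lies on the side where the edge that carries its label starts; the base point lies on
   the side of [v0]. *)
pose A d := if d is Some m then o (j m) else v0.
(* The new edge plays the part of [p]; the exclusive or orients it from [false] to [true], as [turn]
   requires. *)
pose k (l : option T * bool) :=
  if l.1 is Some i then k2 (j (i, l.2)) else k2 (p, l.2 (+) o (p, false)).
case k1qE: (k1 (q, false)) => [[a ba]|] // {k1q}.
have jq : j (a, ba) = (q, false) by apply: jk1.
have jq' : j (a, ~~ ba) = (q, true) by rewrite -[(a, ~~ ba)]/(linv (a, ba)) jV jq.
have jab b : (j (a, b)).1 = q.
  by case: ba b jq jq' {k1qE} => [] [] /= e e'; rewrite ?e ?e'.
have jqa m : (j m).1 = q -> m.1 = a.
  case: m => i b; have := k1j (i, b); case: (j _) => x c /= kx ex.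
  by move: kx; rewrite ex; case: c; [rewrite -[(q, true)]/(linv (q, false)) s1|];
    rewrite k1qE => -[].
exists A, a, k; split.
- split.
  + case=> [[i|] b]; rewrite /k /=; first by rewrite -s2 -jV.
    by rewrite -s2 /linv /= addNb.
  + case=> [[i|] b]; rewrite /k /=; last first.
      by rewrite symN //; apply/negbTE/eqP.
    have -> : (Some i == Some a) = (i == a) by [].
    apply/eqP/eqP => [e | ->].
      have [/jqa // | /eqP jnq] := eqVneq (j (i, b)).1 q.
      by have := dead2 _ e jnq; rewrite k1j.
    apply/eqP; rewrite [j _]surjective_pairing jab symN //; exact/eqP.
  + case=> [[i|] b] [[i'|] b'] m; rewrite /k /= => e e'; have := i2 _ _ _ e e'.
    * by move/(congr1 k1); rewrite !k1j => -[-> ->].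
    * by move/(congr1 fst)/jN.
    * by move/(congr1 fst)/esym/jN.
    * by move=> [/addIb ->].
- rewrite /A; by case: ba jq jq' {k1qE jab jqa} => /= jq jq'; rewrite jq jq' 1?eq_sym // eq_sym.
set u := red (sb (lb k1) w).
have sk : lsym k.
  case=> [[i|] b]; rewrite /k /=; first by rewrite -s2 -jV.
  by rewrite -s2 /linv /= addNb.
have hk := hom_lb sk.
pose kp b := sb (lb k) (pw T b).
(* The substitution carries the [k1] reading of a path to its [k2] reading up to correction factors
   at the two ends. It is enough to check one edge, because the factors telescope. *)
have path_lam v w' v' : gpath o v w' v' ->
    feq (sb (lb k) (sb (lam A) (sb (lb k1) w'))) (kp v ++ sb (lb k2) w' ++ winv (kp v')).
  elim: w' v => [|e w' IHw] v /=; first by move/eqP->; apply/feq_sym/feq_winvr.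
  case/andP=> /eqP ov /IHw {}IHw; rewrite !sb_cons !sb_cat.
  suff He : feq (sb (lb k) (sb (lam A) (lb k1 e))) (kp v ++ lb k2 e ++ winv (kp (o (linv e)))).
    apply: feq_trans (feq_cat He IHw) _; rewrite -!catA; do 2!apply: feq_catl.
    by rewrite catA -[X in feq _ X]cat0s; apply: feq_catr; apply: feq_winvl.
  case k1e: (k1 e) => [m|].
    rewrite (lb_Some k1e) sb_cons cats0 /lam !sb_cat -!/(kp _) sb_winv //.
    have je := jk1 _ _ k1e; rewrite /A -/(kp _) jV je ov; apply: feq_catl.
    apply: feq_catr; rewrite /emb sb_cons cats0 /lb /k /=.
    by rewrite -surjective_pairing je.
  rewrite (lb_None k1e) /=; have [ep | /eqP ep] := eqVneq e.1 p; last first.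
    have [oe k2e] := dead1 _ k1e ep; rewrite (lb_None k2e) -oe ov.
    exact/feq_sym/feq_winvr.
  apply: feq_sym.
  have kpT : kp true = lb k2 (p, o (p, false)) by rewrite /kp /sb /= cats0.
  have kpF : kp false = [::] by [].
  case: e ep ov k1e {IHw} => [e b] /= -> ov _.
  have pT : lb k2 (p, true) = winv (lb k2 (p, false)).
    by rewrite -[(p, true)]/(linv (p, false)); apply: hom_lb.
  move: ov op kpT; rewrite /linv /=; case: b; case opf: (o (p, false));
    case opt: (o (p, true)) => //= <- _ kpT; rewrite ?kpT ?kpF ?cats0 ?cat0s
    ?pT ?winvK; solve [exact: feq_winvr | exact: feq_winvl].
have := path_lam _ _ _ pw0; set x := sb _ (sb _ _) => hx.
apply/feq_sym/(feq_trans (sb_feq hk (blow_lam A u))).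
rewrite !sb_cat sb_winv // -/(kp _) /=.
apply: (@feq_trans _ _ (winv (kp v0) ++ x ++ kp v0)).
  apply: feq_catl; apply: feq_catr; apply: (sb_feq hk); apply: sb_feq (hom_lam A) _.
  exact: feq_red.
apply: (@feq_trans _ _ (winv (kp v0) ++ (kp v0 ++ sb (lb k2) w ++ winv (kp v0)) ++ kp v0)).
  by apply: feq_catl; apply: feq_catr.
rewrite -!catA catA -[X in feq _ X]cat0s; apply: feq_cat (feq_winvl _) _.
by rewrite -[X in feq _ X]cats0; apply: feq_catl; apply: feq_winvl.
Qed.

(** Contracting the new edge itself undoes the blow-up. *)
Definition keep (l : option T * bool) := omap (fun i => (i, l.2)) l.1.

Lemma lab_keep : lab keep None.
Proof.
split; first by case=> [[]].
  by case=> [[]].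
by case=> [[i|] b] [[j|] c] [i' b'] //= [-> ->] [-> ->].
Qed.

Lemma sb_keep_blow A u : sb (lb keep) (blow A u) = u.
Proof.
rewrite /blow sb_blowg; move: None => d; elim: u d => [|l u IHu] d /=.
  by rewrite /turn; case: ifP.
by rewrite IHu /turn /sb /lb /keep /= -surjective_pairing; case: ifP.
Qed.

(** The single path [blow A u] reads [u] when [None] is contracted and the result of the move when
    [a] is contracted; exchanging these two edges in the other direction is the inverse move. *)
Lemma move_sym u u1 : reduced u -> move u u1 -> move u1 u.
Proof.
move=> ru [A [a [k [[sk ka ik] Aa ->]]]].
have [s0 k0 i0] := lab_keep.
rewrite -[X in move _ X](red_id ru) -[X in move _ (red X)](sb_keep_blow A u).
apply: (move_exchange (p := Some a) (q := None) (gpath_blow A u)) => //.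
- by move=> m; apply: lab_surj.
- by apply/eqP; rewrite ka.
- by apply/eqP; rewrite ka.
- by move=> l /eqP; rewrite ka => /eqP.
- by case=> [[]].
Qed.

End ChangeOfTree.

(** * Peak reduction *)

Section Nested.
Variable T : finType.
Implicit Types (u : seq (T * bool)) (P S A B : pred (option (T * bool))).

Notation E2 := (option (option T)).

(* The rose blown up along two disjoint cuts [P] and [S]: the edges [None] and
   [Some None] lead from the complement of [P] and [S] to [P] and to [S]. *)
Definition turn2 P S d d' : seq (E2 * bool) :=
  if (P d == P d') && (S d == S d') then [::] else
  (if P d then [:: (None, true)] else if S d then [:: (Some None, true)] else [::]) ++
  (if P d' then [:: (None, false)] else if S d' then [:: (Some None, false)] else [::]).

Definition emb2 (l : T * bool) : seq (E2 * bool) := [:: (Some (Some l.1), l.2)].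

Definition blow2 P S u := blowg (turn2 P S) emb2 None u.

Definition orig2 P S (l : E2 * bool) :=
  match l.1 with
  | None => (l.2, false)
  | Some None => (false, l.2)
  | Some (Some i) => (P (Some (i, l.2)), S (Some (i, l.2)))
  end.

Lemma orig2_emb P S l : orig2 P S (Some (Some l.1), l.2) = (P (Some l), S (Some l)).
Proof. by rewrite /orig2 /= -surjective_pairing. Qed.

Definition disj P S := forall d, ~~ (P d && S d).

Lemma gpath_blow2 P S u : disj P S ->
  gpath (orig2 P S) (P None, S None) (blow2 P S u) (P None, S None).
Proof.
move=> PS; rewrite /blow2.
have pt d d' : gpath (orig2 P S) (P d, S d) (turn2 P S d d') (P d', S d').
  rewrite /turn2; have := PS d; have := PS d'.
  by case: (P d) (P d') (S d) (S d') => [] [] [] [].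
suff H d : gpath (orig2 P S) (P d, S d) (blowg (turn2 P S) emb2 d u) (P None, S None).
  exact: H.
elim: u d => [|l u IHu] d /=; first exact: pt.
apply: gpath_cat (pt _ _) _; rewrite /= orig2_emb eqxx /=.
by rewrite (orig2_emb P S (linv l)); apply: IHu.
Qed.

Lemma count_blow2 P S u (p : pred (E2 * bool)) : disj P S ->
  count p (blow2 P S u) <= count (fun l : T * bool => p (Some (Some l.1), l.2)) u
    + (p (None, false) || p (None, true)) * cuts P u
    + (p (Some None, false) || p (Some None, true)) * cuts S u.
Proof.
move=> PS; rewrite count_blowg -addnA addnC leq_add //.
  by elim: u => //= l u; rewrite addn0 leq_add2l.
rewrite /cuts; elim: (turns _ _) => //= t s IHs.
rewrite !mulnDr addnACA leq_add // /turn2; have := PS t.1; have := PS t.2.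
case: (P t.1) (P t.2) (S t.1) (S t.2) => [] [] [] [] //= _ _;
by case: (p (None, true)) (p (None, false)) (p (Some None, true)) (p (Some None, false))
  => [] [] [] [].
Qed.

Variables (P S : pred (option (T * bool))).
Hypothesis PS : disj P S.

(** Each of the following labellings contracts two edges of the three-vertex graph. [labP] and
    [labS] recover the two given moves; [labPS], [labPa] and [labSa] give the intermediate words, a
    retained new edge taking over the name of a contracted letter. *)
Definition labP (k : option T * bool -> option (T * bool)) (l : E2 * bool) :=
  match l.1 with
  | None => k (None, l.2)
  | Some None => None
  | Some (Some i) => k (Some i, l.2)
  end.

Definition labS (k : option T * bool -> option (T * bool)) (l : E2 * bool) :=
  match l.1 with
  | None => None
  | Some x => k (x, l.2)
  end.

Definition labPS a b (l : E2 * bool) : option (T * bool) :=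
  match l.1 with
  | None => Some (a, l.2)
  | Some None => Some (b, l.2)
  | Some (Some i) => if (i == a) || (i == b) then None else Some (i, l.2)
  end.

Definition labPa a (l : E2 * bool) : option (T * bool) :=
  match l.1 with
  | None => Some (a, l.2)
  | Some None => None
  | Some (Some i) => if i == a then None else Some (i, l.2)
  end.

Definition labSa a (l : E2 * bool) : option (T * bool) :=
  match l.1 with
  | None => None
  | Some None => Some (a, l.2)
  | Some (Some i) => if i == a then None else Some (i, l.2)
  end.

Lemma sb_labP k u : sb (lb (labP k)) (blow2 P S u) = sb (lb k) (blow P u).
Proof.
rewrite /blow2 /blow !sb_blowg; apply: eq_blowg => // d d'.
rewrite /turn2 /turn; have := PS d; have := PS d'.
by case: (P d) (P d') (S d) (S d') => [] [] [] [].
Qed.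

Lemma sb_labS k u : sb (lb (labS k)) (blow2 P S u) = sb (lb k) (blow S u).
Proof.
rewrite /blow2 /blow !sb_blowg; apply: eq_blowg => // d d'.
rewrite /turn2 /turn; have := PS d; have := PS d'.
by case: (P d) (P d') (S d) (S d') => [] [] [] [].
Qed.

(** The two trees share the edge [r]. Identifying its ends by [mg] leaves a graph with two vertices,
    where [p] is exchanged for [q]. *)
Lemma move_exchange2 (mg : bool * bool -> bool) u p q r
    (k1 k2 : E2 * bool -> option (T * bool)) :
  lsym k1 -> lsym k2 -> linj k1 -> linj k2 ->
  (forall m, exists l, k1 l = Some m) ->
  (forall l, (k1 l == None) = (l.1 == p) || (l.1 == r)) ->
  (forall l, (k2 l == None) = (l.1 == q) || (l.1 == r)) ->
  [&& p != q, p != r & q != r] ->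
  [&& mg (orig2 P S (p, false)) != mg (orig2 P S (p, true)),
      mg (orig2 P S (q, false)) != mg (orig2 P S (q, true)) &
      mg (orig2 P S (r, false)) == mg (orig2 P S (r, true))] ->
  move (red (sb (lb k1) (blow2 P S u))) (red (sb (lb k2) (blow2 P S u))).
Proof.
move=> s1 s2 i1 i2 su N1 N2 /and3P[pq pr qr] /and3P[op oq /eqP or].
apply: (move_exchange (gpath_map mg (gpath_blow2 u PS)) s1 s2 i1 i2 su op oq).
- by apply/eqP; rewrite N1 eqxx.
- by apply/eqP; rewrite N2 (negbTE pq) (negbTE pr).
- by apply/eqP; rewrite N2 eqxx.
- by apply/eqP; rewrite N1 eq_sym (negbTE pq) (negbTE qr).
- move=> [x c] /eqP; rewrite N1 => /orP[/eqP // | /eqP /= -> _].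
  split; last by apply/eqP; rewrite N2 eqxx orbT.
  by case: c; rewrite /linv /= or.
- by move=> [x c] /eqP; rewrite N2 => /orP[/eqP // | /eqP /= -> _];
    apply/eqP; rewrite N1 eqxx orbT.
Qed.

Section Labels.
Variables (k : option T * bool -> option (T * bool)) (a b : T).
Hypothesis kl : lab k (Some a).

Lemma labP_sym : lsym (labP k).
Proof. by case: kl => sk _ _ [[[i|]|] c] //; rewrite /labP /= -sk. Qed.

Lemma labS_sym : lsym (labS k).
Proof. by case: kl => sk _ _ [[[i|]|] c] //; rewrite /labS /= -sk. Qed.

Lemma labP_inj : linj (labP k).
Proof.
case: kl => _ _ ik [[[i|]|] c] [[[j|]|] d] m; rewrite /labP //= => e e';
by have := ik _ _ _ e e'; congruence.
Qed.

Lemma labS_inj : linj (labS k).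
Proof.
case: kl => _ _ ik [[[i|]|] c] [[[j|]|] d] m; rewrite /labS //= => e e';
by have := ik _ _ _ e e'; congruence.
Qed.

Lemma labP_surj m : exists l, labP k l = Some m.
Proof.
have [[[i|] c] e] := lab_surj m kl; first by exists (Some (Some i), c).
by exists (None, c).
Qed.

Lemma labP_None l : (labP k l == None) = (l.1 == Some None) || (l.1 == Some (Some a)).
Proof. by case: kl => _ ka _; case: l => [[[i|]|] c] //=; rewrite /labP /= ka. Qed.

Lemma labS_None l : (labS k l == None) = (l.1 == None) || (l.1 == Some (Some a)).
Proof. by case: kl => _ ka _; case: l => [[[i|]|] c] //=; rewrite /labS /= ka. Qed.

End Labels.

Section Labels2.
Variables (a b : T).

Lemma labPS_sym : lsym (labPS a b).
Proof. by move=> [[[i|]|] c] //; rewrite /labPS /=; case: ifP. Qed.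

Lemma labPa_sym : lsym (labPa a).
Proof. by move=> [[[i|]|] c] //; rewrite /labPa /=; case: ifP. Qed.

Lemma labSa_sym : lsym (labSa a).
Proof. by move=> [[[i|]|] c] //; rewrite /labSa /=; case: ifP. Qed.

Lemma labPS_inj : a != b -> linj (labPS a b).
Proof.
move=> /eqP ab [[[i|]|] c] [[[j|]|] d] [m x]; rewrite /labPS //=;
  repeat case: (_ =P _) => //=; move=> *; congruence.
Qed.

Lemma labPa_inj : linj (labPa a).
Proof.
move=> [[[i|]|] c] [[[j|]|] d] [m x]; rewrite /labPa //=;
  repeat case: (_ =P _) => //=; move=> *; congruence.
Qed.

Lemma labSa_inj : linj (labSa a).
Proof.
move=> [[[i|]|] c] [[[j|]|] d] [m x]; rewrite /labSa //=;
  repeat case: (_ =P _) => //=; move=> *; congruence.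
Qed.

Lemma labPS_surj m : exists l, labPS a b l = Some m.
Proof.
case: m => i c; have [-> | ia] := eqVneq i a; first by exists (None, c).
have [-> | ib] := eqVneq i b; first by exists (Some None, c).
by exists (Some (Some i), c); rewrite /labPS /= (negbTE ia) (negbTE ib).
Qed.

Lemma labPa_surj m : exists l, labPa a l = Some m.
Proof.
case: m => i c; have [-> | ia] := eqVneq i a; first by exists (None, c).
by exists (Some (Some i), c); rewrite /labPa /= (negbTE ia).
Qed.

Lemma labSa_surj m : exists l, labSa a l = Some m.
Proof.
case: m => i c; have [-> | ia] := eqVneq i a; first by exists (Some None, c).
by exists (Some (Some i), c); rewrite /labSa /= (negbTE ia).
Qed.

Lemma labPS_None l : (labPS a b l == None) =
  (l.1 == Some (Some a)) || (l.1 == Some (Some b)).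
Proof.
case: l => [[[i|]|] c] //=; rewrite /labPS /=.
rewrite -[Some (Some i) == Some (Some a)]/(i == a).
by rewrite -[Some (Some i) == Some (Some b)]/(i == b); case: ifP.
Qed.

Lemma labPa_None l : (labPa a l == None) = (l.1 == Some None) || (l.1 == Some (Some a)).
Proof.
case: l => [[[i|]|] c] //=; rewrite /labPa /=.
by rewrite -[Some (Some i) == Some (Some a)]/(i == a); case: ifP.
Qed.

Lemma labSa_None l : (labSa a l == None) = (l.1 == None) || (l.1 == Some (Some a)).
Proof.
case: l => [[[i|]|] c] //=; rewrite /labSa /=.
by rewrite -[Some (Some i) == Some (Some a)]/(i == a); case: ifP.
Qed.

End Labels2.

Definition crosses (A : pred (option (T * bool))) a :=
  A (Some (a, false)) != A (Some (a, true)).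

Lemma size_label (k : E2 * bool -> option (T * bool)) u : lsym k ->
  size (red (sb (lb k) (blow2 P S u))) <=
    count (fun l : T * bool => k (Some (Some l.1), l.2) != None) u
    + (k (None, false) != None) * cuts P u + (k (Some None, false) != None) * cuts S u.
Proof.
move=> sk; apply: leq_trans (size_red _) _; rewrite size_sb_lb.
apply: leq_trans (count_blow2 u (fun l => k l != None) PS) _.
have kT x : (k (x, true) != None) = (k (x, false) != None).
  by rewrite -[(x, true)]/(linv (x, false)) sk; case: (k _).
by rewrite !kT !orbb.
Qed.

(** Of the three vertices, [a] joins that of [P] to another one, and [b] that of [S] to another one.
    A common neighbour tree of the trees of [u1] and [u2] is sought whose word is shorter than
    [u]. *)
Lemma nested u u1 u2 a b k1 k2 : reduced u ->
  nf u u1 P a k1 -> nf u u2 S b k2 ->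
  cuts P u <= occ a u -> cuts S u <= occ b u ->
  cuts P u + cuts S u < occ a u + occ b u ->
  move u1 u2 \/ exists u', [/\ reduced u', size u' < size u, move u1 u' & move u' u2].
Proof.
move=> ru [l1 Pa ->] [l2 Sb ->] ca cb cab.
rewrite -(sb_labP k1) -(sb_labS k2).
have PS' i c := PS (Some (i, c)).
have sideP k l (kl : lab k (Some l)) m :
    (labP k m == None) = (m.1 == Some (Some l)) || (m.1 == Some None).
  by rewrite (labP_None kl) orbC.
have sideS k l (kl : lab k (Some l)) m :
    (labS k m == None) = (m.1 == Some (Some l)) || (m.1 == None).
  by rewrite (labS_None kl) orbC.
have sPS m : (labPS a b m == None) = (m.1 == Some (Some b)) || (m.1 == Some (Some a)).
  by rewrite labPS_None orbC.
have cnt2 (k : E2 * bool -> option (T * bool)) (q : pred T) v :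
    (forall l : T * bool, (k (Some (Some l.1), l.2) != None) = ~~ q l.1) ->
    count (fun l : T * bool => k (Some (Some l.1), l.2) != None) v
      + count (fun l : T * bool => q l.1) v = size v.
  move=> kq; rewrite -(count_predC (fun l : T * bool => q l.1) v) addnC.
  by congr (_ + _); apply: eq_count => l /=; rewrite kq.
have Some2 (i j : T) : (Some (Some i) == Some (Some j) :> E2) = (i == j) by [].
(* A letter that crosses both disjoint cuts joins the vertices of [P] and [S]; it belongs to both
   trees, so one exchange suffices. *)
have [eab | ab] := eqVneq a b.
  subst b; left.
  apply: (@move_exchange2 (fun v => v.1 || v.2) u (Some None) None (Some (Some a)) _ _
    (labP_sym l1) (labS_sym l2) (labP_inj l1) (labS_inj l2) (labP_surj l1)
    (labP_None l1) (labS_None l2)) => //.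
  move: Pa Sb (PS' a false) (PS' a true); rewrite /orig2 /=.
  by case: (P _) (P _) (S _) (S _) => [] [] [] [].
(* The edges [a] and [b] form a spanning tree unless both join the vertices of [P] and [S]. If they
   do, contracting both gives length at most that of [u] plus all cut turns minus both numbers of
   occurrences, which is smaller than that of [u]. *)
have [jab | njab] := boolP ((P (Some (a, false)) || P (Some (a, true))) &&
    [&& (S (Some (a, false)) || S (Some (a, true))),
        (P (Some (b, false)) || P (Some (b, true))) &
        (S (Some (b, false)) || S (Some (b, true)))]); last first.
  right; exists (red (sb (lb (labPS a b)) (blow2 P S u))); split.
  - exact: red_reduced.
  - apply: leq_ltn_trans (size_label u (labPS_sym a b)) _.
    have := cnt2 (labPS a b) (fun i => (i == a) || (i == b)) u.
    have -> : count (fun l : T * bool => (l.1 == a) || (l.1 == b)) u = occ a u + occ b u.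
      rewrite /occ; elim: (u) => //= l v ->; rewrite addnACA; congr (_ + _).
      by case: (l.1 =P a) => [-> | _]; rewrite ?(negbTE ab).
    rewrite /labPS /= !mul1n => <-; last by move=> l; case: ifP.
    by rewrite -addnA ltn_add2l.
  - apply: (@move_exchange2 (if S (Some (a, false)) || S (Some (a, true))
        then fun v => v.1 || v.2 else fun v => v.2) u
      (Some None) (Some (Some b)) (Some (Some a)) _ _
      (labP_sym l1) (labPS_sym a b) (labP_inj l1) (labPS_inj ab) (labP_surj l1)
      (labP_None l1) sPS).
      by rewrite /= !Some2 eq_sym ab.
    move: Pa (PS' a false) (PS' a true) Sb (PS' b false) (PS' b true) njab; rewrite /orig2 /=.
    case: (P (Some (a, _))) (P (Some (a, true))) (S (Some (a, false))) (S (Some (a, true)))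
      => [] [] [] [] //= _ _ _; case: (P (Some (b, _))) (P (Some (b, true)))
      (S (Some (b, false))) (S (Some (b, true))) => [] [] [] [] //.
  - apply: (@move_exchange2 (if P (Some (b, false)) || P (Some (b, true))
        then fun v => v.1 || v.2 else fun v => v.1) u
      (Some (Some a)) None (Some (Some b)) _ _
      (labPS_sym a b) (labS_sym l2) (labPS_inj ab) (labS_inj l2) (labPS_surj a b)
      (labPS_None a b) (labS_None l2)).
      by rewrite /= !Some2 ab.
    move: Pa (PS' a false) (PS' a true) Sb (PS' b false) (PS' b true) njab; rewrite /orig2 /=.
    case: (P (Some (a, _))) (P (Some (a, true))) (S (Some (a, false))) (S (Some (a, true)))
      => [] [] [] [] //= _ _ _; case: (P (Some (b, _))) (P (Some (b, true)))
      (S (Some (b, false))) (S (Some (b, true))) => [] [] [] [] //.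
have cntA (k : E2 * bool -> option (T * bool)) c :
    (forall l, (k (Some (Some l.1), l.2) != None) = ~~ (l.1 == c)) ->
    count (fun l : T * bool => k (Some (Some l.1), l.2) != None) u + occ c u = size u.
  by move=> kc; apply: (cnt2 k (fun i => i == c)).
(* Now [a] and [b] are parallel edges. If [a] occurs more often than [S] cuts, the edge of [P] and
   [a] are contracted; otherwise the strict sum makes [b] occur more often than [P] cuts, and the
   edge of [S] and [b] are contracted. *)
have [Sa | Sa] := ltnP (cuts S u) (occ a u).
  right; exists (red (sb (lb (labSa a)) (blow2 P S u))); split.
  - exact: red_reduced.
  - apply: leq_ltn_trans (size_label u (labSa_sym a)) _.
    have := cntA (labSa a) a; rewrite /labSa /= mul0n mul1n addn0.
    move=> <-; last by move=> l; case: ifP.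
    by rewrite ltn_add2l.
  - apply: (@move_exchange2 (fun v => v.1 || v.2) u
      (Some None) None (Some (Some a)) _ _
      (labP_sym l1) (labSa_sym a) (labP_inj l1) (@labSa_inj a) (labP_surj l1)
      (labP_None l1) (labSa_None a)) => //.
    move: Pa Sb (PS' a false) (PS' a true) jab; rewrite /orig2 /=.
    by case: (P (Some (a, _))) (P (Some (a, true))) (S (Some (a, false))) (S (Some (a, true)))
      => [] [] [] [].
  - apply: (@move_exchange2 (fun v => v.2) u
      (Some (Some a)) (Some (Some b)) None _ _
      (labSa_sym a) (labS_sym l2) (@labSa_inj a) (labS_inj l2) (labSa_surj a) _ (sideS _ _ l2)).
    + by move=> l; rewrite labSa_None orbC.
    + by rewrite /= !Some2 ab.
    move: Pa (PS' a false) (PS' a true) Sb (PS' b false) (PS' b true) jab; rewrite /orig2 /=.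
    case: (P (Some (a, _))) (P (Some (a, true))) (S (Some (a, false))) (S (Some (a, true)))
      => [] [] [] [] //= _ _ _; case: (P (Some (b, _))) (P (Some (b, true)))
      (S (Some (b, false))) (S (Some (b, true))) => [] [] [] [] //.
have Pb : cuts P u < occ b u.
  by rewrite -(ltn_add2l (occ a u)); apply: leq_ltn_trans cab; rewrite addnC leq_add2l.
right; exists (red (sb (lb (labPa b)) (blow2 P S u))); split.
- exact: red_reduced.
- apply: leq_ltn_trans (size_label u (labPa_sym b)) _.
  have := cntA (labPa b) b; rewrite /labPa /= mul0n mul1n addn0.
  move=> <-; last by move=> l; case: ifP.
  by rewrite ltn_add2l.
- apply: (@move_exchange2 (fun v => v.1) u
    (Some (Some a)) (Some (Some b)) (Some None) _ _
    (labP_sym l1) (labPa_sym b) (labP_inj l1) (@labPa_inj b) (labP_surj l1) (sideP _ _ l1)).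
  + by move=> l; rewrite labPa_None orbC.
  + by rewrite /= !Some2 ab.
  move: Pa (PS' a false) (PS' a true) Sb (PS' b false) (PS' b true) jab; rewrite /orig2 /=.
  case: (P (Some (a, _))) (P (Some (a, true))) (S (Some (a, false))) (S (Some (a, true)))
    => [] [] [] [] //= _ _ _; case: (P (Some (b, _))) (P (Some (b, true)))
    (S (Some (b, false))) (S (Some (b, true))) => [] [] [] [] //.
- apply: (@move_exchange2 (fun v => v.1 || v.2) u
    (Some None) None (Some (Some b)) _ _
    (labPa_sym b) (labS_sym l2) (@labPa_inj b) (labS_inj l2) (labPa_surj b)
    (labPa_None b) (labS_None l2)) => //.
  move: Pa Sb (PS' b false) (PS' b true) jab; rewrite /orig2 /=.
  by case: (P (Some (b, _))) (P (Some (b, true))) (S (Some (b, false))) (S (Some (b, true)))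
    => [] [] [] []; rewrite ?andbF.
Qed.

End Nested.

(** * Uncrossing of cuts and removal of peaks from chains *)

Section PeakReduction.
Variable T : finType.
Implicit Types (x y z u : seq (T * bool)) (A B P : pred (option (T * bool))).

Inductive chain (C : nat) : seq (T * bool) -> seq (T * bool) -> Prop :=
| chain_nil x : reduced x -> size x <= C -> chain C x x
| chain_cons x y z : reduced x -> size x <= C -> move x y -> chain C y z -> chain C x z.

Lemma chain_trans C x y z : chain C x y -> chain C y z -> chain C x z.
Proof. by elim=> // x1 x2 x3 r1 s1 m12 _ IH /IH; apply: chain_cons. Qed.

Lemma chain_red C x y : chain C x y ->
  [/\ reduced x, size x <= C, reduced y & size y <= C].
Proof. by elim=> [// | x1 x2 x3 r1 s1 _ _ [_ _ r3 s3]]. Qed.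

Lemma chain_le C C' x y : C <= C' -> chain C x y -> chain C' x y.
Proof.
move=> CC; elim=> [x1 r1 s1 | x1 x2 x3 r1 s1 m12 _ IH].
  by apply: chain_nil => //; apply: leq_trans CC.
by apply: chain_cons m12 IH => //; apply: leq_trans CC.
Qed.

Lemma move_reduced x y : move x y -> reduced y.
Proof. by case=> A [a [k [_ _ ->]]]; apply: red_reduced. Qed.

Lemma chain1 C x y : reduced x -> size x <= C -> size y <= C -> move x y -> chain C x y.
Proof.
move=> rx sx sy mxy; apply: (chain_cons rx sx mxy); apply: chain_nil => //.
exact: move_reduced mxy.
Qed.

Definition kstd (p : T) (l : option T * bool) : option (T * bool) :=
  if l.1 is Some i then if i == p then None else Some (i, l.2) else Some (p, l.2).

Lemma lab_kstd p : lab (kstd p) (Some p).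
Proof.
split.
- by move=> [[i|] c] //; rewrite /kstd /=; case: ifP.
- move=> [[i|] c] //; rewrite /kstd /= -[Some i == Some p]/(i == p).
  by case: ifP.
- move=> [[i|] c] [[j|] d] [m e]; rewrite /kstd /=;
  repeat case: (_ =P _) => //=; move=> *; congruence.
Qed.

(* Uncrossing: by submodularity of [cuts] some corner of two crossing cuts
   strictly shortens [u]. *)
Lemma corner_reducing A B a b u : crosses A a -> crosses B b ->
  cuts A u < occ a u -> cuts B u <= occ b u ->
  exists (c d : bool) p, crosses (corner A B c d) p /\ cuts (corner A B c d) u < occ p u.
Proof.
move=> Aa Bb cA cB.
have sub c d : cuts (corner A B c d) u + cuts (corner A B (~~ c) (~~ d)) u < occ a u + occ b u.
  by apply: leq_ltn_trans (cuts_corner _ _ _ _ _) _; rewrite -addSn leq_add.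
(* If [p] and [q] cross opposite corners and together occur at least as often as [a] and [b],
   submodularity makes one of the two corners reducing. *)
have pick2 c d p q : crosses (corner A B c d) p -> crosses (corner A B (~~ c) (~~ d)) q ->
    occ a u + occ b u <= occ p u + occ q u ->
    exists (c d : bool) p, crosses (corner A B c d) p /\ cuts (corner A B c d) u < occ p u.
  move=> c1 c2 le; have := leq_trans (sub c d) le.
  have [lt1 _ | le1] := ltnP (cuts (corner A B c d) u) (occ p u); first by exists c, d, p.
  move=> lt; exists (~~ c), (~~ d), q; split=> //.
  by rewrite -(ltn_add2l (occ p u)); apply: leq_ltn_trans lt; rewrite leq_add2r.
have ab : occ a u + occ b u <= occ a u + occ b u by [].
have ba : occ a u + occ b u <= occ b u + occ a u by rewrite addnC.
(* In most positions [a] and [b] cross two opposite corners, one each. Otherwise they join different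
   pairs of opposite corners, and the more frequent letter serves for both corners of its own
   pair. *)
have [le_ab | lt_ba] := leqP (occ b u) (occ a u).
  have aa : occ a u + occ b u <= occ a u + occ a u by rewrite leq_add2l.
  move: pick2 Aa Bb; rewrite /crosses /corner => pick2 Aa Bb.
  have := (pick2 true true a b, pick2 true true b a, pick2 true false a b,
           pick2 true false b a, pick2 true true a a, pick2 true false a a).
  case=> [[[[[h1 h2] h3] h4] h5] h6]; move: Aa Bb h1 h2 h3 h4 h5 h6.
  case: (A _) (A _) (B (Some (a, _))) (B (Some (a, true))) => [] [] [] [] //=;
  case: (A _) (A _) (B (Some (b, _))) (B (Some (b, true))) => [] [] [] [] //= _ _ h1 h2 h3 h4 h5 h6;
  by [apply: h1 | apply: h2 | apply: h3 | apply: h4 | apply: h5 | apply: h6].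
have bb : occ a u + occ b u <= occ b u + occ b u by rewrite leq_add2r ltnW.
move: pick2 Aa Bb; rewrite /crosses /corner => pick2 Aa Bb.
have := (pick2 true true a b, pick2 true true b a, pick2 true false a b,
         pick2 true false b a, pick2 true true b b, pick2 true false b b).
case=> [[[[[h1 h2] h3] h4] h5] h6]; move: Aa Bb h1 h2 h3 h4 h5 h6.
case: (A _) (A _) (B (Some (a, _))) (B (Some (a, true))) => [] [] [] [] //=;
case: (A _) (A _) (B (Some (b, _))) (B (Some (b, true))) => [] [] [] [] //= _ _ h1 h2 h3 h4 h5 h6;
  by [apply: h1 | apply: h2 | apply: h3 | apply: h4 | apply: h5 | apply: h6].
Qed.

(** The final move to [u2] stays outside the chain because [u2] may be as long as [u]. *)
Lemma disj_peak u u1 u2 P S a b k1 k2 : reduced u -> disj P S ->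
  nf u u1 P a k1 -> nf u u2 S b k2 -> size u1 < size u -> size u2 <= size u ->
  exists2 x, chain (size u).-1 u1 x & move x u2.
Proof.
move=> ru PS n1 n2 s1 s2.
have e1 := nf_size ru n1; have e2 := nf_size ru n2.
have r1 : reduced u1 by case: n1 => _ _ ->; apply: red_reduced.
have c1 : cuts P u < occ a u.
  by rewrite -(ltn_add2l (size u)) -e1 ltn_add2r.
have c2 : cuts S u <= occ b u.
  by rewrite -(leq_add2l (size u)) -e2 leq_add2r.
have lt_le n : n < size u -> n <= (size u).-1 by case: (size u).
have [|m12|[u' [r' s' m1 m2]]] := nested PS ru n1 n2 (ltnW c1) c2.
- by rewrite -addSn leq_add.
- by exists u1 => //; apply: chain_nil => //; apply: lt_le.
- by exists u' => //; apply: chain1 m1 => //; apply: lt_le.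
Qed.

Lemma nf_side u u1 A a k (c : bool) : nf u u1 A a k ->
  exists A' k', nf u u1 A' a k' /\ A' =1 (fun d => A d != c).
Proof.
case: c => n1; last by exists A, k; split=> // d; case: (A d).
by have [k' n'] := nf_compl n1; exists (predC A), k'; split=> // d /=; case: (A d).
Qed.

(** The reducing corner is disjoint from one side of each cut, so the word [u3] it produces splits
    the peak into two peaks with disjoint cuts. *)
Lemma peak u u1 u2 : reduced u -> move u u1 -> move u u2 ->
  size u1 < size u -> size u2 <= size u ->
  exists2 x, chain (size u).-1 u1 x & move x u2.
Proof.
move=> ru [A [a [k1 n1]]] [B [b [k2 n2]]] s1 s2.
have [Aa Bb] : crosses A a /\ crosses B b by case: n1 n2 => _ Aa _ [].
have e1 := nf_size ru n1; have e2 := nf_size ru n2.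
have c1 : cuts A u < occ a u by rewrite -(ltn_add2l (size u)) -e1 ltn_add2r.
have c2 : cuts B u <= occ b u by rewrite -(leq_add2l (size u)) -e2 leq_add2r.
have [c [d [p [cp lt_p]]]] := corner_reducing Aa Bb c1 c2.
have [A' [k1' [n1' A'E]]] := nf_side c n1.
have [B' [k2' [n2' B'E]]] := nf_side d n2.
pose u3 := red (sb (lb (kstd p)) (blow (corner A B c d) u)).
have n3 : nf u u3 (corner A B c d) p (kstd p) by split; [apply: lab_kstd | apply: cp |].
have s3 := nf_size ru n3.
have lt3 : size u3 < size u by rewrite -(ltn_add2r (occ p u)) s3 ltn_add2l.
have [|x ch1 m1] := disj_peak ru _ n1' n3 s1 (ltnW lt3).
  by move=> e; rewrite A'E /corner /=; case: (A e == c).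
have [|y ch2 m2] := disj_peak ru _ n3 n2' lt3 s2.
  by move=> e; rewrite B'E /corner /=; case: (B e == d); rewrite ?andbF.
exists y => //; apply: (chain_trans ch1).
have [_ _ rx sx] := chain_red ch1.
apply: chain_cons m1 ch2 => //.
Qed.

Lemma chain_lower C x y :
  chain C.+1 x y -> size x <= C -> size y <= C -> chain C x y.
Proof.
(* The induction carries the word [x0] before the current one. If [y0] has length C+1, the peak is
   replaced by a lower chain to some [x'], which then precedes the next word, possibly again a
   peak. *)
suff H y0 z : chain C.+1 y0 z -> forall x0, reduced x0 -> size x0 <= C ->
    move x0 y0 -> size z <= C -> chain C x0 z.
  move=> [x0 r0 _ s0 _ | x0 x1 x2 r0 _ m01 ch s0 s2]; first exact: chain_nil.
  exact: (H _ _ ch _ r0 s0 m01 s2).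
elim=> {y0 z} [z rz _ | y0 y1 z r0 s0 m01 ch IH] x0 rx sx m0 sz.
  exact: chain1.
have [le0 | lt0] := leqP (size y0) C.
  by apply: (chain_cons rx sx m0); apply: IH.
have e0 : size y0 = C.+1 by apply/eqP; rewrite eqn_leq s0.
have [_ s1 _ _] := chain_red ch.
have [||x' ch1 m1] := peak r0 (move_sym rx m0) m01; rewrite ?e0 //.
rewrite e0 /= in ch1; have [_ _ rx' sx'] := chain_red ch1.
by apply: (chain_trans ch1); apply: IH.
Qed.

Lemma chain_bound C x y : chain C x y -> chain (maxn (size x) (size y)) x y.
Proof.
elim: C => [|C IHC] ch; have [rx sx ry sy] := chain_red ch.
  by apply: chain_le ch; lia.
have [le | lt] := leqP (maxn (size x) (size y)) C; last exact: chain_le ch.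
by apply/IHC/chain_lower => //; apply: leq_trans le; rewrite ?leq_maxl ?leq_maxr.
Qed.

End PeakReduction.

(** * Nielsen reduced substitutions *)

Section SelfCancellation.
Variable T : eqType.
Implicit Types (s r : seq (T * bool)).

(** Stripping the outer letters leaves a shorter word of the same kind; a middle letter would be its
    own inverse, and an empty middle would make the two outer letters cancel. *)
Lemma winv_fixed r : winv r = r -> reduced r -> r = [::].
Proof.
have [n le_n] := ubnP (size r); elim: n r le_n => // n IHn [|x r] //= le_n.
case/lastP: r le_n => [|q y] le_n; first by case=> /eqP; rewrite linv_neq.
rewrite winv_cons /winv map_rcons rev_rcons -/(winv q) -cats1 /= => -[<-].
move=> e rq; have eq : winv q = q.
  by move: e => /eqP; rewrite eqseq_cat ?size_winv // => /andP[/eqP].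
have rq' : reduced q.
  move: rq; rewrite -[path _ _ _]/(reduced (_ :: (q ++ _))) reduced_cons.
  by case/andP=> _ /reduced_cat[].
have q0 : q = [::] by apply: IHn => //; move: le_n; rewrite size_rcons; lia.
by move: rq; rewrite q0 /= linvK eqxx.
Qed.

(** If at least half of [s] cancelled in the square of [s], then [s] would be a conjugate of a word
    [r] equal to its own inverse, hence trivial. *)
Lemma cp_self s : reduced s -> s <> [::] -> (cp s s).*2 < size s.
Proof.
move=> rs s0; rewrite ltnNge; apply/negP => le.
have [p [s' [t' [e1 e2 szp _]]]] := cpP s s; rewrite -szp in le.
have sz : size s' + size p = size s by rewrite [in RHS]e1 size_cat size_winv.
have sz' : size p + size t' = size s by rewrite [in RHS]e2 size_cat.
have ep : p = s' ++ drop (size s') p.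
  rewrite -[LHS](cat_take_drop (size s')); congr (_ ++ _).
  transitivity (take (size s') s); last by rewrite e1 take_size_cat.
  by rewrite e2 takel_cat //; lia.
set r := drop _ _ in ep.
have er : winv r = r.
  move: e2; rewrite [LHS]e1 {1}ep winv_cat {1}ep -catA => /eqP.
  rewrite eqseq_cat // eqxx /= => /eqP/(congr1 (take (size r))).
  by rewrite !take_size_cat // size_winv.
have rr : reduced r.
  have : reduced p by case: (@reduced_cat _ p t'); rewrite -?e2.
  by rewrite ep => /reduced_cat[].
have r0 := winv_fixed er rr.
apply: s0; apply: feq_reduced => //; rewrite e1 ep r0 cats0.
exact: feq_winvr.
Qed.

Lemma lcp_prefix s k (t t' : seq (T * bool)) :
  lcp s t < k -> k <= size t -> lcp s (take k t ++ t') = lcp s t.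
Proof.
elim: s t k => [|x s IHs] [|y t] [|k] //=; case: eqP => // _.
by rewrite !ltnS => h1 h2; rewrite IHs.
Qed.

End SelfCancellation.

Section NielsenReduced.
Variables (T X : eqType).
Implicit Types (I : pred T) (Y : T * bool -> seq (X * bool)) (w : seq (T * bool)).

(** Nielsen's conditions in terms of cancellation lengths, for three consecutive letters of a
    reduced word: at most half of each factor cancels, and part of the middle factor survives.
    Nontriviality of the images follows from the strict inequality. *)
Definition nr_at Y l m p :=
  (m != linv l) && (p != linv m) ==>
  [&& (cp (Y l) (Y m)).*2 <= size (Y l), (cp (Y l) (Y m)).*2 <= size (Y m) &
      cp (Y l) (Y m) + cp (Y m) (Y p) < size (Y m)].

Definition nielsen I Y := forall l m p, I l.1 -> I m.1 -> I p.1 -> nr_at Y l m p.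

Lemma neq_linv (l : T * bool) : l != linv l.
Proof. by rewrite eq_sym linv_neq. Qed.

Lemma nielsen_gt0 I Y l : nielsen I Y -> I l.1 -> 0 < size (Y l).
Proof.
move=> nY Il; have := nY l l l Il Il Il; rewrite /nr_at !neq_linv /=.
by case/and3P=> _ _; apply: leq_ltn_trans.
Qed.

Section Bounds.
Variables (I : pred T) (Y : T * bool -> seq (X * bool)).
Hypotheses (nY : nielsen I Y) (rY : forall l, reduced (Y l)).

Definition nextc l w := if w is m :: _ then cp (Y l) (Y m) else 0.

(** Induction from the right end of the word. Keeping track of the surviving initial piece of [Y l]
    is what allows a further factor to be put in front. *)
Lemma nielsen_product l w : reduced (l :: w) -> all (fun x => I x.1) (l :: w) ->
  let r := red (sb Y (l :: w)) in
  [/\ exists s, r = take (size (Y l) - nextc l w) (Y l) ++ s,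
      nextc l w < size (Y l),
      size (Y l) - nextc l w + size w <= size r &
      all (fun x => size (Y x) <= size r) (l :: w)].
Proof.
elim: w l => [|m w IHw] l rw /=.
  rewrite andbT => Il; rewrite sb_cons cats0 red_id // subn0 take_size.
  split; rewrite ?addn0 ?leqnn //; first by exists [::]; rewrite cats0.
  exact: nielsen_gt0 Il.
case/and3P=> Il Im Iw.
have /andP[ne rw'] : (m != linv l) && reduced (m :: w) by move: rw; rewrite reduced_cons.
have [|[s es] c_lt szm szw] := IHw m rw'; first by rewrite /= Im.
set r' := red _ in es szm szw.
(* When [m] is the last letter, nothing cancels on its right, and the triple l, m, m supplies the
   bounds. *)
have [c2l c2m cc] : [/\ (cp (Y l) (Y m)).*2 <= size (Y l),
    (cp (Y l) (Y m)).*2 <= size (Y m) & cp (Y l) (Y m) + nextc m w < size (Y m)].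
  case: w rw' Iw {IHw rw szm szw r' es c_lt} => [_ _|p w rw' /= /andP[Ip _]].
    have := nY Il Im Im; rewrite /nr_at ne neq_linv /= => /and3P[h1 h2 h3].
    by split=> //; apply: leq_ltn_trans h3; rewrite addn0 leq_addr.
  have := nY Il Im Ip; rewrite /nr_at ne /=.
  by case/andP: rw' => -> _ /and3P[].
(* The surviving initial piece of [Y m] is longer than what [Y l] cancels, so only [Y m] is felt. *)
have cpE : cp (Y l) r' = cp (Y l) (Y m).
  by rewrite es {1}/cp lcp_prefix ?leq_subr // -/(cp _ _) ltn_subRL addnC.
have rr' : reduced r' by apply: red_reduced.
have er : red (sb Y (l :: m :: w)) = red (Y l ++ r').
  by apply: feq_catl; apply: feq_sym; apply: feq_red.
have szr : size (red (Y l ++ r')) = size (Y l) + size r' - (cp (Y l) (Y m)).*2.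
  by rewrite size_red_cat // cpE.
have /andP[szm' szw'] : (size (Y m) <= size r') && all (fun x => size (Y x) <= size r') w.
  exact: szw.
have Yl0 := nielsen_gt0 nY Il.
rewrite er; split.
- by rewrite cp_split // cpE; eexists.
- lia.
- rewrite szr; lia.
- rewrite szr; apply/andP; split; first by lia.
  apply/andP; split; first by lia.
  by apply: sub_all szw' => x /= le; lia.
Qed.

Lemma nielsen_size w : reduced w -> all (fun x => I x.1) w ->
  size w <= size (red (sb Y w)).
Proof.
case: w => // l w rw Iw; have [_ lt le _] := nielsen_product rw Iw.
by apply: leq_trans le; rewrite /= -add1n leq_add2r subn_gt0.
Qed.

Lemma nielsen_letter w x : reduced w -> all (fun x => I x.1) w -> x \in w ->
  size (Y x) <= size (red (sb Y w)).
Proof.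
case: w => // l w rw Iw; have [_ _ _ /allP h] := nielsen_product rw Iw.
exact: h.
Qed.

End Bounds.

Definition inj_sub Y := forall w, feq (sb Y w) [::] -> feq w [::].

Lemma nielsen_inj Y : hom Y -> (forall l, reduced (Y l)) -> nielsen predT Y -> inj_sub Y.
Proof.
move=> hY rY nY w; rewrite /feq -(sb_red w hY) => e.
have := nielsen_size nY rY (red_reduced w); rewrite e /= all_predT => /(_ isT).
by rewrite leqn0 size_eq0 => /eqP.
Qed.

End NielsenReduced.

Section Rank.
Variable X : finType.
Implicit Types (s t p q : seq X).

(** The word read as a numeral in base [#|X|]: the lexicographic order on words of equal length. *)
Definition rank s := foldl (fun r x => r * #|X| + enum_rank x) 0 s.

Lemma rank_rcons s x : rank (rcons s x) = rank s * #|X| + enum_rank x.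
Proof. by rewrite /rank -cats1 foldl_cat. Qed.

Lemma rank_mono p q t : rank p < rank q -> rank (p ++ t) < rank (q ++ t).
Proof.
elim/last_ind: t => [|t x IHt]; rewrite ?cats0 // -!rcons_cat !rank_rcons => /IHt lt.
rewrite ltn_add2r ltn_pmul2r //; exact: leq_ltn_trans (ltn_ord (enum_rank x)).
Qed.

Lemma rank_inj p q : size p = size q -> rank p = rank q -> p = q.
Proof.
elim/last_ind: p q => [|p x IHp] q; first by case: q.
case/lastP: q => [|q y]; rewrite !size_rcons // => -[sz]; rewrite !rank_rcons => e.
have X0 : 0 < #|X| by apply: leq_ltn_trans (ltn_ord (enum_rank x)).
have ex : x = y.
  have := congr1 (modn^~ #|X|) e; rewrite !modnMDl !modn_small //.
  by move/ord_inj/enum_rank_inj.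
rewrite ex in e *; congr rcons; apply: IHp => //.
by move/addIn/eqP: e; rewrite eqn_pmul2r // => /eqP.
Qed.

End Rank.

Lemma uphalf_bounds h n : h.*2 <= n -> (h <= uphalf n) * (uphalf n <= n - h).
Proof. by split; lia. Qed.

Lemma ltn_sum_pointwise (I : finType) (f g : I -> nat) i :
  (forall j, f j <= g j) -> f i < g i -> \sum_j f j < \sum_j g j.
Proof.
move=> le lt; rewrite (bigD1 i) //= [X in _ < X](bigD1 i) //=.
by rewrite -addSn; apply: leq_add => //; apply: leq_sum.
Qed.

(** * Nielsen reduction by transvections *)

Section Transvection.
Variable T : finType.
Implicit Types (l m : T * bool) (u w : seq (T * bool)).

Definition transv m l x : seq (T * bool) :=
  if x == m then [:: linv l; m] else if x == linv m then [:: linv m; l] else [:: x].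

Lemma hom_transv m l : hom (transv m l).
Proof.
move=> x; rewrite /transv (inj_eq (@linv_inj _)) eq_linv.
case: (x =P m) => [-> | nx].
  by rewrite (negbTE (neq_linv m)) /winv /rev /= linvK.
by case: (x =P linv m) => _; rewrite /winv /rev /= ?linvK.
Qed.

Lemma move_transv u m l : m.1 != l.1 -> move u (red (sb (transv m l) u)).
Proof.
move=> ml.
(* The cut holds the end of [l] and the start of [m]. Entering it through the new edge, read as
   [linv l], produces the factor in front of [m], while [l] is contracted and reappears when the cut
   is left. *)
pose A d := (d == Some (linv l)) || (d == Some m).
pose k (x : option T * bool) : option (T * bool) :=
  if x.1 is Some i then if i == l.1 then None else Some (i, x.2)
  else Some (if x.2 then l else linv l).
have lk : lab k (Some l.1).
  split.
  - move=> [[i|] c]; rewrite /k /=; first by case: ifP.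
    by case: c; rewrite /= ?linvK.
  - move=> [[i|] c]; rewrite /k //= -[Some i == _]/(i == l.1).
    by case: ifP.
  - move=> [[i|] c] [[j|] d] x; rewrite /k /=.
    + by case: eqP => // _; case: eqP => // _ [<-] [-> ->].
    + by case: (i =P l.1) => // il [<-] []; case: d => /(congr1 fst) /= e; rewrite e in il.
    + by case: (j =P l.1) => // jl [<-] []; case: c => /(congr1 fst) /= e; rewrite e in jl.
    + by move=> [<-] []; case: c; case: d => // /eqP; rewrite ?linv_neq // eq_sym linv_neq.
have Al x : A (Some x) = (x == linv l) || (x == m) by [].
exists A, l.1, k; split=> //.
  have lm c : (l.1, c) == m = false by apply/negbTE; apply: contra ml => /eqP <-.
  by rewrite !Al !lm !orbF; case: (l) => i []; rewrite /linv /= !xpair_eqE /= eqxx.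
have [sk _ _] := lk.
apply/feq_sym/(feq_trans (sb_feq (hom_lb sk) (blow_lam A u))).
rewrite /= cats0 sb_sb; apply: eq_sb_feq => x.
rewrite /lam !sb_cat sb_winv; last exact: hom_lb.
have kp (b : bool) : sb (lb k) (pw T b) = if b then [:: linv l] else [::] by case: b.
have ke : sb (lb k) (emb x) = if x.1 == l.1 then [::] else [:: x].
  by rewrite /emb sb_cons cats0 /lb /k /=; case: ifP => // _; rewrite -surjective_pairing.
rewrite !kp ke !Al (inj_eq (@linv_inj _)) eq_linv /transv.
have [-> | xm] := eqVneq x m.
  have -> : (m == l) = false by apply/negbTE; apply: contra ml => /eqP ->.
  by rewrite (negbTE ml) orbT (negbTE (neq_linv m)) /=.
rewrite orbF; have [-> | xlm] := eqVneq x (linv m).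
  have -> : (linv m == l) = false by apply/negbTE; apply: contra ml => /eqP <-.
  rewrite (inj_eq (@linv_inj _)).
  have -> : (m == l) = false by apply/negbTE; apply: contra ml => /eqP ->.
  by rewrite /= (negbTE ml) /winv /rev /= linvK.
rewrite orbF; case: (x.1 =P l.1) => [/letter_same[->|->] | xl].
- by rewrite eqxx (negbTE (neq_linv l)) /winv /rev /= linvK.
- by rewrite eqxx linv_neq.
have -> : (x == linv l) = false by apply/eqP => e; rewrite e in xl.
by have -> : (x == l) = false by apply/eqP => e; rewrite e in xl.
Qed.

Lemma transvK m l w : m.1 != l.1 -> feq (sb (transv m l) (sb (transv m (linv l)) w)) w.
Proof.
move=> ml; have sb1 : sb (fun x => [:: x]) w = w by elim: w => // x w IHw; rewrite sb_cons IHw.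
rewrite sb_sb -[X in feq _ X]sb1; apply: eq_sb_feq => x.
have f1 y : y.1 = l.1 -> transv m l y = [:: y].
  move=> e; rewrite /transv; case: eqP => [ym | _]; first by rewrite -ym e eqxx in ml.
  by case: eqP => // ym; rewrite -e ym eqxx in ml.
rewrite {2}/transv; case: (x =P m) => [-> | xm].
  rewrite linvK sb_cons f1 // sb_cons /transv eqxx.
  exact: (@pushK _ l [:: m]).
case: (x =P linv m) => [-> | xlm].
  rewrite !sb_cons (f1 (linv l)) // /transv linv_neq eqxx.
  by rewrite /feq; congr (push (linv m) _); apply: (@pushK _ l [::]).
by rewrite /sb /= cats0 /transv; case: eqP => // _; case: eqP.
Qed.

Variable X : finType.
Implicit Types (Y : T * bool -> seq (X * bool)).

(** [Y] composed with the inverse transvection, so that moving the word by [transv m l] leaves the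
    value unchanged. *)
Definition upd Y m l x :=
  if x == m then red (Y l ++ Y m) else
  if x == linv m then red (Y (linv m) ++ Y (linv l)) else Y x.

Lemma hom_upd Y m l : hom Y -> hom (upd Y m l).
Proof.
move=> hY x; rewrite /upd (inj_eq (@linv_inj _)) eq_linv.
case: (x =P m) => [-> | nx].
  by rewrite (negbTE (neq_linv m)) -red_winv winv_cat !hY.
by case: (x =P linv m) => _ //; rewrite -red_winv winv_cat !hY !winvK.
Qed.

Lemma upd_reduced Y m l : (forall x, reduced (Y x)) -> forall x, reduced (upd Y m l x).
Proof.
by move=> rY x; rewrite /upd; do 2?[case: ifP => // _]; apply: red_reduced.
Qed.

Lemma upd_transv Y m l w : hom Y -> feq (sb (upd Y m l) w) (sb Y (sb (transv m (linv l)) w)).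
Proof.
move=> hY; rewrite sb_sb; apply: eq_sb_feq => x; rewrite /upd /transv linvK.
case: eqP => _; first by rewrite !sb_cons cats0; apply: feq_red.
by case: eqP => _; rewrite !sb_cons cats0 //; apply: feq_red.
Qed.

Lemma upd_inj Y m l : m.1 != l.1 -> hom Y -> inj_sub Y -> inj_sub (upd Y m l).
Proof.
move=> ml hY iY w /(feq_trans (feq_sym (upd_transv m l w hY))) /iY e.
apply: feq_trans (feq_sym (transvK (l := l) w ml)) _.
exact: (sb_feq (hom_transv m l) e).
Qed.

Lemma upd_value Y m l w : m.1 != l.1 -> hom Y ->
  feq (sb (upd Y m l) (sb (transv m l) w)) (sb Y w).
Proof.
move=> ml hY; apply: feq_trans (upd_transv _ _ _ hY) _; apply: sb_feq => //.
by rewrite -{2}(linvK l); apply: transvK.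
Qed.

Definition half s : seq (X * bool) := take (uphalf (size s)) s.

(* The substitutions are compared by total length first, and then by the ranks of
   the left halves of the images of the letters. *)
Definition len Y := \sum_x size (Y x).
Definition hrank Y := \sum_x rank (half (Y x)).

Lemma len_upd Y m l : hom Y -> size (red (Y l ++ Y m)) < size (Y m) -> len (upd Y m l) < len Y.
Proof.
move=> hY lt; apply: (@ltn_sum_pointwise _ _ _ m); last by rewrite /upd eqxx.
move=> x; rewrite /upd; case: eqP => [-> | _]; first exact: ltnW.
case: eqP => [-> | _] //.
rewrite -[Y _ ++ _]winvK red_winv size_winv winv_cat -!hY !linvK.
by rewrite [in X in _ <= X]hY size_winv ltnW.
Qed.

(** If exactly half of [Y l] cancels, the product is [Y m] with its first [h] letters replaced by
    the left half of [Y l], which has smaller rank; lengths stay the same. *)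
Lemma rank_upd Y m l : hom Y -> (forall x, reduced (Y x)) ->
  let h := cp (Y l) (Y m) in
  size (Y l) = h.*2 -> h.*2 <= size (Y m) ->
  rank (take h (Y l)) < rank (take h (winv (Y l))) ->
  len (upd Y m l) = len Y /\ hrank (upd Y m l) < hrank Y.
Proof.
move=> hY rY h; have hE : cp (Y l) (Y m) = h by [].
move: h hE => h hE szl le lt.
have [leh1 leh2] := cp_le (Y l) (Y m); rewrite hE in leh1 leh2.
have eY : Y m = take h (winv (Y l)) ++ drop h (Y m).
  have [p [s' [t' [e1 e2 szp _]]]] := cpP (Y l) (Y m).
  rewrite hE in szp.
  by rewrite e1 winv_cat winvK e2 -szp take_size_cat // drop_size_cat.
have eU : red (Y l ++ Y m) = take h (Y l) ++ drop h (Y m).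
  by rewrite cp_split // hE szl -addnn addnK.
have szU : size (red (Y l ++ Y m)) = size (Y m).
  by rewrite eU size_cat size_takel // size_drop subnKC.
have eV : red (Y (linv m) ++ Y (linv l)) = winv (red (Y l ++ Y m)).
  by rewrite -red_winv winv_cat -!hY.
split.
  apply: eq_bigr => x _; rewrite /upd; case: eqP => [-> // | _].
  by case: eqP => [-> | //]; rewrite eV size_winv szU hY size_winv.
apply: (@ltn_sum_pointwise _ _ _ m); last first.
  rewrite /upd eqxx /half szU eU [X in _ < rank (take _ X)]eY.
  rewrite !take_cat !size_takel ?size_winv //.
  have -> : uphalf (size (Y m)) < h = false by rewrite ltnNge (uphalf_bounds le).1.
  exact: rank_mono.
move=> x; rewrite /upd; case: eqP => [-> | _].
  rewrite /half szU eU [X in _ <= rank (take _ X)]eY.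
  rewrite !take_cat !size_takel ?size_winv //.
  have -> : uphalf (size (Y m)) < h = false by rewrite ltnNge (uphalf_bounds le).1.
  exact/ltnW/rank_mono.
(* The change affects only the last [h] letters of the inverse, which lie beyond its left half. *)
have takeV s : take (uphalf (size (Y m))) (winv (s ++ drop h (Y m))) =
    take (uphalf (size (Y m))) (winv (drop h (Y m))).
  by rewrite winv_cat takel_cat // size_winv size_drop (uphalf_bounds le).2.
case: eqP => [-> | //]; rewrite eV hY /half !size_winv szU eU takeV.
by rewrite -(takeV (take h (winv (Y l)))) -eY.
Qed.

Definition nielsen_chain Y := forall u, reduced u -> exists w Y' C,
  [/\ chain C u w, hom Y', forall x, reduced (Y' x), nielsen predT Y' &
      feq (sb Y' w) (sb Y u)].

Lemma nielsen_chain_upd Y m l : m.1 != l.1 -> hom Y ->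
  nielsen_chain (upd Y m l) -> nielsen_chain Y.
Proof.
move=> ml hY IH u ru.
have [w [Y' [C [ch hY' rY' nY' eY']]]] := IH _ (red_reduced (sb (transv m l) u)).
exists w, Y', (maxn (size u) C); split=> //.
  apply: (chain_cons ru (leq_maxl _ _) (move_transv u ml)).
  exact: chain_le (leq_maxr _ _) ch.
apply: feq_trans eY' _; apply: feq_trans (upd_value u ml hY).
by apply: sb_feq; [apply: hom_upd | apply: feq_red].
Qed.

(** Nested induction on [len] and [hrank]: any failure of Nielsen's conditions permits a
    transvection that lowers one of them. *)
Lemma nielsen_reduction Y : hom Y -> (forall x, reduced (Y x)) -> inj_sub Y ->
  nielsen_chain Y.
Proof.
have [n] := ubnP (len Y); elim: n Y => // n IHn Y.
have [k] := ubnP (hrank Y); elim: k Y => // k IHk Y rkY lenY hY rY iY.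
have IH m l : m.1 != l.1 ->
    len (upd Y m l) < len Y \/ len (upd Y m l) = len Y /\ hrank (upd Y m l) < hrank Y ->
    nielsen_chain Y.
  move=> ml dec; apply: (nielsen_chain_upd ml hY).
  have [hU rU iU] : [/\ hom (upd Y m l), forall x, reduced (upd Y m l x) & inj_sub (upd Y m l)].
    by split; [apply: hom_upd | apply: upd_reduced | apply: upd_inj].
  case: dec => [lt | [eq lt]].
    by apply: IHn => //; apply: leq_trans lt _.
  by apply: IHk => //; [apply: leq_trans lt _ | rewrite eq].
have Y0 x : Y x <> [::].
  move=> e; have : feq [:: x] [::] by apply: iY; rewrite sb_cons e.
  by rewrite /feq.
(* A letter cannot cancel half of itself, so the two letters are distinct and a transvection is
   available. *)
have noself l m : m != linv l -> size (Y l) <= (cp (Y l) (Y m)).*2 -> m.1 != l.1.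
  move=> ne le; apply/eqP => /letter_same[e | e]; last by rewrite e eqxx in ne.
  by have := cp_self (rY l) (Y0 l); rewrite e in le; rewrite ltnNge le.
pose bad1 l m := (m != linv l) && (size (Y l) < (cp (Y l) (Y m)).*2).
have cpV l m : cp (Y (linv m)) (Y (linv l)) = cp (Y l) (Y m).
  by rewrite !hY cp_winv.
have [/existsP[l /existsP[m /andP[ne lt]]] | no1] := boolP [exists l, exists m, bad1 l m].
  apply: (IH m l); first exact: noself ne (ltnW lt).
  left; apply: len_upd => //; rewrite size_red_cat //.
  have := cp_le (Y l) (Y m) => -[_]; move: lt.
  by move: (cp _ _) (size (Y l)) (size (Y m)) => c p q; lia.
have N1 l m : m != linv l -> (cp (Y l) (Y m)).*2 <= size (Y l).
  move=> ne; move: no1; rewrite negb_exists => /forallP/(_ l).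
  rewrite negb_exists => /forallP/(_ m); rewrite /bad1 ne /=.
  by rewrite -leqNgt.
have N2 l m : m != linv l -> (cp (Y l) (Y m)).*2 <= size (Y m).
  move=> ne; rewrite -cpV -(size_winv (Y m)) -hY; apply: N1.
  by rewrite (inj_eq (@linv_inj _)) -eq_linv eq_sym.
(* With at most half cancelling everywhere, the middle factor [Y m] can vanish only if exactly half
   of it cancels on each side. *)
have [/existsP[l /existsP[m /existsP[p]]] | no2] :=
    boolP [exists l, exists m, exists p, ~~ nr_at Y l m p]; last first.
  move=> u ru; exists u, Y, (size u); split=> //; first exact: chain_nil.
  move=> l m p _ _ _; move: no2; rewrite negb_exists => /forallP/(_ l).
  rewrite negb_exists => /forallP/(_ m); rewrite negb_exists => /forallP/(_ p).
  by rewrite negbK.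
rewrite /nr_at negb_imply => /andP[/andP[ne1 ne2]].
rewrite N1 // N2 //= -leqNgt => le.
have [e1 e2] : size (Y m) = (cp (Y l) (Y m)).*2 /\ size (Y m) = (cp (Y m) (Y p)).*2.
  have := N2 l m ne1; have := N1 m p ne2; move: le.
  by move: (cp _ _) (cp _ _) (size (Y m)) => c c' q; lia.
have ec : cp (Y l) (Y m) = cp (Y m) (Y p) by apply: double_inj; rewrite -e1.
(* If the left half of [Y m] ranks below that of its inverse, [Y m] is multiplied into [Y p]; in the
   opposite case it is multiplied, from the right, into [Y l]. Equality would make [Y m] trivial. *)
have [lt | gt | eq] := ltngtP (rank (take (cp (Y m) (Y p)) (Y m)))
    (rank (take (cp (Y m) (Y p)) (winv (Y m)))).
- apply: (IH p m); first by apply: noself ne2 _; rewrite -e2.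
  right; exact: (rank_upd hY rY e2 (N2 _ _ ne2) lt).
- have ne1' : linv l != linv (linv m).
    by rewrite (inj_eq (@linv_inj _)) -eq_linv eq_sym.
  have sz1 : size (Y (linv m)) = (cp (Y (linv m)) (Y (linv l))).*2.
    by rewrite cpV hY size_winv.
  apply: (IH (linv l) (linv m)); first by apply: noself ne1' _; rewrite -sz1.
  right; apply: (rank_upd hY rY sz1 (N2 _ _ ne1')).
  by rewrite cpV ec hY winvK.
case: (Y0 m); apply: feq_reduced => //.
have e : take (cp (Y m) (Y p)) (Y m) = take (cp (Y m) (Y p)) (winv (Y m)).
  apply: rank_inj eq; have le2 : cp (Y m) (Y p) <= size (Y m) by case: (cp_le (Y m) (Y p)).
  by rewrite !size_takel // size_winv.
have [q [s' [t' [eY _ szq _]]]] := cpP (Y m) (Y p).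
have szs : size s' = cp (Y m) (Y p).
  have := congr1 size eY; rewrite size_cat size_winv szq e2 -addnn.
  by move/eqP; rewrite eqn_add2r eq_sym => /eqP.
move: e szq szs; move: (cp _ _) => c; rewrite eY winv_cat winvK => e szq szs.
by rewrite !take_size_cat // in e; rewrite e; apply: feq_winvr.
Qed.

End Transvection.

(** * Injective substitutions *)

Section MoveSubstitution.
Variable T : finType.
Implicit Types (u w : seq (T * bool)).

(** Conjugation by the path to the base point is applied letter by letter, where the inner factors
    telescope, so one substitution serves all words. *)
Lemma blow_sub (A : pred (option (T * bool))) (k : option T * bool -> option (T * bool)) u :
  lsym k -> let f l := sb (lb k) (winv (pw T (A None)) ++ lam A l ++ pw T (A None)) in
  feq (sb (lb k) (blow A u)) (sb f u).
Proof.
move=> sk f; apply: feq_trans (sb_feq (hom_lb sk) (blow_lam A u)) _.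
set g := lam A; rewrite !sb_cat; elim: u => [|l u IHu].
  by rewrite sb_winv; [apply: feq_winvl | apply: hom_lb].
rewrite !sb_cons sb_cat.
have -> : f l = sb (lb k) (winv (pw T (A None))) ++ sb (lb k) (g l) ++ sb (lb k) (pw T (A None)).
  by rewrite /f -/g; move: (g l) => gl; rewrite !sb_cat.
set a := sb _ (winv _); set b := sb _ (pw _ _).
rewrite -!catA; apply: feq_catl; apply: feq_catl.
apply: (@feq_trans _ _ (b ++ (a ++ sb (lb k) (sb g u) ++ b))).
  rewrite (catA b a) -[X in feq X _]cat0s; apply: feq_catr; apply: feq_sym.
  by rewrite /a sb_winv; [apply: feq_winvr | apply: hom_lb].
exact: feq_catl.
Qed.

(** The 5 counts the letter, at most two new edges around it, and at most two from the
    conjugation. *)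
Lemma move_sub u u1 : reduced u -> move u u1 -> exists f : T * bool -> seq (T * bool),
  [/\ hom f, forall l, size (f l) <= 5, inj_sub f & red (sb f u) = u1].
Proof.
move=> ru [A [a [k [lk Aa ->]]]]; have [sk ka ik] := lk.
exists (fun l => sb (lb k) (winv (pw T (A None)) ++ lam A l ++ pw T (A None))).
have hf : hom (fun l => sb (lb k) (winv (pw T (A None)) ++ lam A l ++ pw T (A None))).
  by move=> l; rewrite (hom_lam A) -sb_winv ?winv_cat ?winvK -?catA //; apply: hom_lb.
split=> //.
- move=> l; apply: (@leq_trans (1 * 5)) => //.
  apply: leq_trans (size_sb (k := 1) _ _) _; first by move=> x; rewrite /lb; case: (k x).
  rewrite leq_mul2l /lam !size_cat !size_winv.
  have p1 b : size (pw T b) <= 1 by case: b.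
  by rewrite -[5]/(1 + (1 + (1 + 1) + 1)) !leq_add.
(* If the substitution kills [w], the same cut moves the reduced form of [w] to the empty word; the
   inverse move starts from the empty word and so can only return the empty word. *)
- move=> w e; have rw := red_reduced w.
  have m : move (red w) (red (sb (lb k) (blow A (red w)))) by exists A, a, k.
  have e0 : feq (sb (lb k) (blow A (red w))) [::].
    apply: (feq_trans (blow_sub A (red w) sk)); apply: feq_trans e.
    exact: sb_red.
  rewrite (e0 : red _ = [::]) in m; have [B [b [k' [_ _ e']]]] := move_sym rw m.
  rewrite /feq e'.
  by rewrite /blow /= /turn eqxx.
- by apply/feq_sym; apply: blow_sub.
Qed.

End MoveSubstitution.

(** * Extending a Nielsen reduced family to all letters *)

Section Extension.
Variable T : finType.
Hypothesis card_T : 1 < #|T|.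
Variables (I : pred T) (Y : T * bool -> seq (T * bool)).
Hypotheses (hY : hom Y) (rY : forall l, reduced (Y l)) (nY : nielsen I Y).

(* Words [t^e c t^-e] with [t] different from the first letters of all [Y l] can
   be added to a Nielsen reduced family. *)
Let word (t : T * bool) (c : T) (x : T * bool) : seq (T * bool) :=
  let e := (enum_rank x.1).+1 in nseq e t ++ (c, x.2) :: nseq e (linv t).

Lemma lcp_nseq (t a b : T * bool) (e : nat) s s' : a != b ->
  lcp (nseq e t ++ a :: s) (nseq e t ++ b :: s') = e.
Proof. by move=> ab; elim: e => [|e IHe] /=; rewrite ?(negbTE ab) ?eqxx ?IHe. Qed.

(** Words with different exponents part where [c] meets [t]; with equal exponents they come from
    inverse letters and part at the middle letter. *)
Lemma lcp_word t c x y : c != t.1 -> x != y ->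
  lcp (word t c x) (word t c y) <= minn (enum_rank x.1).+1 (enum_rank y.1).+1.
Proof.
move=> ct; wlog le : x y / enum_rank x.1 <= enum_rank y.1 => [H xy | xy].
  have [le | /ltnW le] := leqP (enum_rank x.1) (enum_rank y.1); first exact: H.
  by rewrite lcpC minnC; apply: H; rewrite // eq_sym.
rewrite (minn_idPl _) // /word; move: le; rewrite leq_eqVlt => /orP[/eqP e | lt].
  rewrite -e lcp_nseq // xpair_eqE eqxx /=; apply: contra xy => /eqP e2.
  move/ord_inj/enum_rank_inj: e => e1.
  by rewrite [x]surjective_pairing [y]surjective_pairing e1 e2.
have [s ->] : exists s, nseq (enum_rank y.1).+1 t = nseq (enum_rank x.1).+1 t ++ t :: s.
  exists (nseq (enum_rank y.1 - enum_rank x.1).-1 t).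
  by rewrite -[t :: _]/(nseq _.+1 t) -nseqD; congr nseq; lia.
by rewrite -catA lcp_nseq //; apply: contra ct => /eqP <-.
Qed.

(** If every signed letter started some image, choosing one such image for each would be an
    injection, hence a surjection, reaching a letter outside [I]. *)
Lemma exists_free_letter i : ~~ I i ->
  exists t, forall x s, I x.1 -> Y x <> t :: s.
Proof.
move=> Ii.
have [/forallP h | ] := boolP [forall t : T * bool, exists x : T * bool,
    I x.1 && (ohead (Y x) == Some t)].
  have /fin_all_exists[f hf] : forall t, exists x, I x.1 && (ohead (Y x) == Some t).
    by move=> t; apply/existsP.
  have inj_f : injective f.
    move=> t t' e; have /andP[_ /eqP] := hf t; have /andP[_ /eqP] := hf t'.
    by rewrite e => -> [].
  have /codomP[t e] : (i, true) \in codom f by apply: injF_onto.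
  by have /andP[] := hf t; rewrite -e (negbTE Ii).
rewrite negb_forall => /existsP[t]; rewrite negb_exists => /forallP h.
exists t => x s Ix e; have := h x; by rewrite Ix e eqxx.
Qed.

(** An added word begins with [t], so it cancels nothing against the old images. Two added words
    cancel at most the power of [t] between them, so the middle letter keeps each added word
    alive. *)
Lemma nielsen_extend : exists Y', [/\ hom Y', forall l, reduced (Y' l), nielsen predT Y' &
  forall l, I l.1 -> Y' l = Y l].
Proof.
have [/forallP allI | ] := boolP [forall i, I i].
  by exists Y; split=> // l m p _ _ _; apply: nY.
rewrite negb_forall => /existsP[i Ii]; have [t ht] := exists_free_letter Ii.
(* Here the rank must be at least 2. *)
have [c ct] : exists c, c != t.1.
  have : 0 < #|predC1 t.1| by rewrite cardC1; lia.
  by case/card_gt0P => c; exists c.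
have wordV x : word t c (linv x) = winv (word t c x).
  by rewrite /word winv_cat winv_cons /winv !map_nseq linvK !rev_nseq -catA.
have rword x : reduced (word t c x).
  have ct' b : (c, b) != linv t by apply: contra ct => /eqP/(congr1 fst) /= ->.
  have tc b : linv t != linv (c, b).
    by rewrite (inj_eq (@linv_inj _)); apply: contra ct => /eqP/(congr1 fst) /= ->.
  have rn (a : T * bool) n s : reduced s -> (if s is b :: _ then b != linv a else true) ->
      reduced (nseq n a ++ s).
    move=> rs hs; elim: n => // n IHn.
    rewrite -[nseq n.+1 a ++ s]/(a :: (nseq n a ++ s)) reduced_cons IHn andbT.
    by case: n {IHn} => //= n; apply: neq_linv.
  apply: (rn t); last exact: ct'.
  rewrite reduced_cons -[nseq _ _]cats0 rn // andbT /=; exact: tc.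
pose Y' x := if I x.1 then Y x else word t c x.
have Y't x : I x.1 -> forall s, Y' x <> t :: s by move=> Ix s; rewrite /Y' Ix; apply: ht.
have wt x : exists s, word t c x = t :: s by eexists.
have hY' : hom Y' by move=> x; rewrite /Y' /=; case: ifP.
have cpE x y : cp (Y' x) (Y' y) = lcp (Y' (linv x)) (Y' y) by rewrite /cp hY'.
have lcp0 x y : I x.1 -> ~~ I y.1 -> lcp (Y' x) (Y' y) = 0.
  move=> Ix /negbTE Iy; rewrite [Y' y]/Y' Iy; have [s ->] := wt y.
  by case: (Y' x) (Y't x Ix) => // a s' ne /=; case: eqP => // ea; case: (ne s'); rewrite ea.
have cp_mix x y : I x.1 != I y.1 -> cp (Y' x) (Y' y) = 0.
  rewrite cpE; case Ix: (I x.1); case Iy: (I y.1) => // _.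
    by rewrite lcp0 // Iy.
  by rewrite lcpC lcp0 // Ix.
pose e x := (enum_rank (x : T * bool).1 : nat).+1.
have cp_out x y : I x.1 = false -> I y.1 = false -> y != linv x ->
    cp (Y' x) (Y' y) <= minn (e x) (e y).
  move=> Ix Iy ne; rewrite cpE /Y' /= Ix Iy.
  by apply: (lcp_word ct (x := linv x)); rewrite eq_sym.
have sz x : I x.1 = false -> size (Y' x) = (e x).*2.+1.
  by move=> Ix; rewrite /Y' Ix size_cat /= !size_nseq /e addnS addnn.
have sz0 x : 0 < size (Y' x).
  by case Ix: (I x.1); [rewrite /Y' Ix; apply: (nielsen_gt0 nY Ix) | rewrite sz].
have N1 x y : y != linv x -> (cp (Y' x) (Y' y)).*2 <= size (Y' x) /\
    (cp (Y' x) (Y' y)).*2 <= size (Y' y).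
  move=> ne; case Ixy: (I x.1 == I y.1); last by rewrite cp_mix ?Ixy.
  case Ix: (I x.1); move: Ixy; rewrite Ix eq_sym => /eqP Iy.
    have := nY Ix Iy Iy; rewrite /nr_at ne neq_linv /= => /and3P[h1 h2 _].
    by rewrite /Y' Ix Iy.
  have := cp_out x y Ix Iy ne; rewrite !sz //.
  by move: (cp _ _) (e x) (e y) => n1 n2 n3; lia.
exists Y'; split=> //.
- by move=> l; rewrite /Y'; case: ifP.
- move=> l m p _ _ _; rewrite /nr_at; apply/implyP => /andP[ne1 ne2].
  have [-> ->] := N1 l m ne1; have [h1 _] := N1 m p ne2; have [_ h2] := N1 l m ne1.
  rewrite /=; have := sz0 m; case Im: (I m.1).
    case Il: (I l.1); last first.
      by rewrite cp_mix ?Il ?Im //; move: h1; move: (cp _ _) (size _) => n1 n2; lia.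
    case Ip: (I p.1); last first.
      by rewrite addnC cp_mix ?Ip ?Im //; move: h2; move: (cp _ _) (size _) => n1 n2; lia.
    have := nY Il Im Ip; rewrite /nr_at ne1 ne2 /= => /and3P[_ _].
    by rewrite /Y' Il Im Ip.
  have out1 : cp (Y' l) (Y' m) <= e m.
    case Il: (I l.1); first by rewrite cp_mix ?Il ?Im.
    exact: leq_trans (cp_out _ _ Il Im ne1) (geq_minr _ _).
  have out2 : cp (Y' m) (Y' p) <= e m.
    case Ip: (I p.1); first by rewrite cp_mix ?Ip ?Im.
    exact: leq_trans (cp_out _ _ Im Ip ne2) (geq_minl _ _).
  by move=> _; rewrite sz // ltnS -addnn; apply: leq_add.
- by move=> l Il; rewrite /Y' Il.
Qed.

End Extension.

(** * The algorithm *)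

(** Classical, since [P] has no decision procedure; this is harmless because the resulting list is a
    constant of the algorithm. *)
Lemma filter_prop (T : eqType) (P : T -> Prop) (s : seq T) :
  exists s' : seq T, forall x, x \in s' <-> x \in s /\ P x.
Proof.
elim: s => [|y s [s' hs']]; first by exists [::] => x; split=> // -[].
have [Py | nPy] := classic (P y).
  exists (y :: s') => x; rewrite !inE; split.
    by case/orP=> [/eqP -> | /hs'[-> Px]]; rewrite ?eqxx ?orbT.
  by case=> /orP[-> // | xs Px]; apply/orP; right; apply/hs'.
exists s' => x; rewrite inE; split; first by case/hs' => -> Px; rewrite orbT.
by case=> /orP[/eqP -> // | xs Px]; apply/hs'.
Qed.

Section Enumeration.
Variable n : nat.
Notation L := ('I_n * bool)%type.
Implicit Types (u v w : seq L) (g : seq (seq L)).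

Definition all_words k : seq (seq L) :=
  iter k (fun S => [::] :: flatten [seq [seq l :: s | s <- S] | l <- enum {: L}]) [:: [::]].

Lemma mem_all_words k w : size w <= k -> w \in all_words k.
Proof.
elim: k w => [|k IHk] [|l w] //= le; rewrite inE.
apply/flatten_mapP; exists l; first by rewrite mem_enum.
by apply: map_f; apply: IHk.
Qed.

Definition tuples k (S : seq (seq L)) : seq (seq (seq L)) :=
  iter k (fun G => flatten [seq [seq y :: g | g <- G] | y <- S]) [:: [::]].

Lemma mem_tuples k S g : size g = k -> all (mem S) g -> g \in tuples k S.
Proof.
elim: k g => [|k IHk] [|y g] //= [sz] /andP[yS gS].
by apply/flatten_mapP; exists y => //; apply: map_f; apply: IHk.
Qed.

Definition sub_of g (l : L) := if l.2 then winv (nth [::] g l.1) else nth [::] g l.1.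

Lemma hom_sub_of g : hom (sub_of g).
Proof. by case=> i []; rewrite /sub_of /= ?winvK. Qed.

Definition images_of (Y : L -> seq L) := [seq Y (i, false) | i <- enum 'I_n].

Lemma size_images_of Y : size (images_of Y) = n.
Proof. by rewrite size_map size_enum_ord. Qed.

Lemma images_ofK Y : hom Y -> sub_of (images_of Y) =1 Y.
Proof.
move=> hY l; have E : nth [::] (images_of Y) l.1 = Y (l.1, false).
  by rewrite (nth_map l.1) ?size_enum_ord // nth_ord_enum.
by rewrite /sub_of E; case: l {E} => i []; rewrite //= -hY.
Qed.

Lemma eq_sb (f g : L -> seq L) w : f =1 g -> sb f w = sb g w.
Proof. by move=> fg; rewrite /sb (eq_map fg). Qed.

Variable W : seq (seq (seq L)).
Hypothesis W_sound : forall g, g \in W -> inj_sub (sub_of g).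
Hypothesis W_complete : forall u v, reduced u -> move u v ->
  exists2 g, g \in W & red (sb (sub_of g) u) = v.

Definition step (S : seq (seq L)) :=
  S ++ flatten [seq [seq red (sb (sub_of g) s) | g <- W] | s <- S].

Definition reach k u := iter k step [:: u].

Lemma reach_sound k u w : w \in reach k u -> exists f : L -> seq L,
  [/\ hom f, inj_sub f & feq (sb f u) w].
Proof.
elim: k w => [|k IHk] w /=.
  rewrite inE => /eqP ->; exists (fun l => [:: l]).
  have sb1 v : sb (fun l : L => [:: l]) v = v by elim: v => // l v IHv; rewrite sb_cons IHv.
  by split=> // [v|]; rewrite sb1.
rewrite mem_cat => /orP[/IHk // | /flatten_mapP[s /IHk[f [hf jf ef]] /mapP[g gW ->]]].
have hg := hom_sub_of g.
exists (fun l => sb (sub_of g) (f l)); split; first exact: hom_sb.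
  by move=> v; rewrite -sb_sb => /(W_sound gW) /jf.
by rewrite -sb_sb; apply: feq_trans (sb_feq hg ef) _; apply/feq_sym/feq_red.
Qed.

Lemma reach_step k u s v : s \in reach k u -> reduced s -> move s v -> v \in reach k.+1 u.
Proof.
move=> sk rs m; have [g gW e] := W_complete rs m.
rewrite /= mem_cat; apply/orP; right; apply/flatten_mapP; exists s => //.
by rewrite -e; apply: (map_f (fun g => red (sb (sub_of g) s))).
Qed.

Lemma reach_mono k k' u v : k <= k' -> v \in reach k u -> v \in reach k' u.
Proof.
move=> /subnK <-; elim: (k' - k) => //= d IHd /IHd vk.
by rewrite mem_cat vk.
Qed.

Fixpoint mpath u p v :=
  if p is w :: p' then move u w /\ mpath w p' v else u = v.

Lemma mpath_reach p k u v w : u \in reach k w -> all (@reduced _) (u :: p) -> mpath u p v ->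
  v \in reach (k + size p) w.
Proof.
elim: p k u => [|x p IHp] k u uk /=; first by move=> _ <-; rewrite addn0.
case/and3P=> ru rx rp [m mp]; rewrite addnS -addSn.
by apply: (IHp _ x) => //; [apply: reach_step m | rewrite /= rx].
Qed.

Lemma mpath_split u p1 x p2 v : mpath u (p1 ++ x :: p2) v -> mpath x p2 v.
Proof. by elim: p1 u => [|y p1 IHp] u /= [_] // /IHp. Qed.

(** Removing the loops from a chain leaves a path without repetitions. *)
Lemma chain_mpath C u v : chain C u v -> exists p,
  [/\ mpath u p v, uniq (u :: p) & all (fun w => reduced w && (size w <= C)) (u :: p)].
Proof.
elim=> {u v} [u ru su | u x v ru su m _ [p [mp up ap]]].
  by exists [::]; rewrite /= ru su.
have [uxp | nuxp] := boolP (u \in x :: p); last first.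
  exists (x :: p); split=> //; first by rewrite cons_uniq nuxp.
  by rewrite /= ru su.
(* If [u] recurs later, the part before that recurrence is dropped. *)
have [p1 [p2 e]] : exists p1 p2, x :: p = p1 ++ u :: p2.
  by case/splitPr: uxp => p1 p2; exists p1, p2.
exists p2; split.
- case: p1 e => [|y p1] [ex ep]; first by rewrite -ex -ep.
  by apply: (@mpath_split x p1); rewrite -ep.
- by move: up; rewrite e cat_uniq => /and3P[].
- by move: ap; rewrite e all_cat => /andP[].
Qed.

(** A path without repetitions through words of length at most [C] has no more vertices than the
    list of all such words. *)
Lemma reach_complete C u v : chain C u v -> v \in reach (size (all_words C)) u.
Proof.
move=> /chain_mpath[p [mp up ap]].
have ap' : all (@reduced _) (u :: p) by apply: sub_all ap => w /andP[].
have := mpath_reach (k := 0) (w := u) (mem_head _ _) ap' mp; apply: reach_mono.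
have sub : {subset u :: p <= all_words C}.
  by move=> w /(allP ap) /andP[_]; apply: mem_all_words.
by rewrite add0n; apply: ltnW; apply: (uniq_leq_size up sub).
Qed.

(* A form of [(cp s t).*2] that avoids the double recursion of [lcp]. *)
Definition canc (s t : seq L) := size s + size t - size (red (s ++ t)).

Lemma cancE s t : reduced s -> reduced t -> canc s t = (cp s t).*2.
Proof.
move=> rs rt; rewrite /canc size_red_cat // subKn //.
by have := cp_le s t; rewrite -addnn => -[c1 c2]; apply: leq_add.
Qed.

(** As [canc] is twice the cancellation, the last inequality is doubled. *)
Definition nr_test g l m p :=
  let yl := sub_of g l in let ym := sub_of g m in
  [&& canc yl ym <= size yl, canc yl ym <= size ym &
      canc yl ym + canc ym (sub_of g p) < size ym + size ym].

Definition letters_test (w : seq L) (b : L -> L -> L -> bool) :=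
  all (fun l => all (fun m => all (fun p =>
    if [&& has (fun x => x.1 == l.1) w, has (fun x => x.1 == m.1) w,
           has (fun x => x.1 == p.1) w, m != linv l & p != linv m]
    then b l m p else true) (enum {: L})) (enum {: L})) (enum {: L}).

Definition good g w v :=
  [&& all (fun l => red (sub_of g l) == sub_of g l) (enum {: L}),
      letters_test w (nr_test g) & red (sb (sub_of g) w) == v].

(** A suitable [w] is no longer than [v0], so the sum of the two lengths bounds every word on a
    peak-reduced chain from [u0] to [w]. *)
Definition decide u v :=
  let u0 := red u in let v0 := red v in
  has (fun w => has (fun g => good g w v0) (tuples n (all_words (size v0))))
    (reach (size (all_words (size u0 + size v0))) u0).

Definition supp w (i : 'I_n) := has (fun x : L => x.1 == i) w.

Lemma goodP g w v : reduced v ->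
  reflect [/\ forall l, reduced (sub_of g l), nielsen (supp w) (sub_of g) &
              feq (sb (sub_of g) w) v] (good g w v).
Proof.
move=> rv; have rP l : (red (sub_of g l) == sub_of g l) = reduced (sub_of g l).
  by apply/eqP/idP => [<- | /red_id //]; apply: red_reduced.
apply: (iffP and3P) => [[/allP r1 t1 /eqP e] | [r1 t1 e]].
  have rg l : reduced (sub_of g l) by rewrite -rP; apply: r1; rewrite mem_enum.
  split=> //; last by rewrite /feq e red_id.
  move=> l m p sl sm sp; rewrite /nr_at; apply/implyP => /andP[ne1 ne2].
  have := allP t1 l; rewrite mem_enum => /(_ isT) /allP/(_ m).
  rewrite mem_enum => /(_ isT) /allP/(_ p); rewrite mem_enum => /(_ isT).
  rewrite -/(supp w l.1) -/(supp w m.1) -/(supp w p.1) sl sm sp ne1 ne2 /= /nr_test.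
  by rewrite !cancE // => /and3P[-> ->]; rewrite -!doubleD addnn ltn_double.
split.
- by apply/allP => l _; rewrite rP.
- apply/allP => l _; apply/allP => m _; apply/allP => p _.
  case: ifP => // /and5P[sl sm sp ne1 ne2].
  have := t1 l m p sl sm sp; rewrite /nr_at ne1 ne2 /= /nr_test !cancE //.
  by case/and3P=> -> -> /=; rewrite -!doubleD addnn ltn_double.
- by rewrite -[v]red_id //; apply/eqP.
Qed.

Hypothesis n_gt1 : 1 < n.

Lemma eq_sb_supp (f g : L -> seq L) w : (forall l, supp w l.1 -> f l = g l) ->
  sb f w = sb g w.
Proof.
move=> fg; rewrite /sb; congr flatten; apply/eq_in_map => l lw.
by apply: fg; apply/hasP; exists l.
Qed.

Lemma decideP u v : decide u v <-> exists Y : L -> seq L,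
  [/\ hom Y, forall l, reduced (Y l), inj_sub Y & feq (sb Y u) v].
Proof.
have rv := red_reduced v; split.
  case/hasP=> w /reach_sound[f [hf jf ef]] /hasP[g _ /(goodP _ _ rv)[rg ng eg]].
  have hg := hom_sub_of g.
  have cT : 1 < #|'I_n| by rewrite card_ord.
  (* The substitution found is Nielsen reduced only on the letters of [w]; it is replaced by an
     injective one with the same value at [w]. *)
  have [Y [hY rY nY eY]] := nielsen_extend cT hg rg ng.
  have jY := nielsen_inj hY rY nY.
  exists (fun l => red (sb Y (f l))).
  have hYf : hom (fun l => sb Y (f l)) by apply: hom_sb.
  have redf w' : feq (sb (fun l => red (sb Y (f l))) w') (sb Y (sb f w')).
    by rewrite sb_sb; apply: eq_sb_feq => l; apply: feq_red.
  split=> //; first exact: hom_red.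
  - by move=> l; apply: red_reduced.
  - by move=> w' /(feq_trans (feq_sym (redf w'))) /jY /jf.
  apply: feq_trans (redf u) _.
  have ef' : feq (sb f u) w.
    by apply: feq_trans ef; apply: (sb_feq hf); apply/feq_sym/feq_red.
  apply: feq_trans (sb_feq hY ef') _.
  rewrite (eq_sb_supp eY); apply: feq_trans eg _; exact: feq_red.
case=> Y0 [hY0 rY0 jY0 e0].
have [w [Y [C [ch hY rY nY eY]]]] := nielsen_reduction hY0 rY0 jY0 (red_reduced u).
have [_ _ rw _] := chain_red ch.
have e1 : red (sb Y w) = red v.
  by rewrite eY; apply: feq_trans e0; apply: sb_feq (feq_red _).
have szw : size w <= size (red v).
  by rewrite -e1; apply: (nielsen_size nY rY rw); apply/allP.
have szY x : x \in w -> size (Y x) <= size (red v).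
  by move=> xw; rewrite -e1; apply: (nielsen_letter nY rY rw) => //; apply/allP.
(* Letters outside [w] have images of uncontrolled length; the empty word stands in for them so that
   the tuple lies in the searched list. *)
pose Y' l := if supp w l.1 then Y l else [::].
have hY' : hom Y' by move=> l; rewrite /Y' /=; case: ifP.
apply/hasP; exists w.
  apply: reach_complete; apply: chain_le (chain_bound ch).
  by rewrite geq_max leq_addr /=; apply: leq_trans szw (leq_addl _ _).
apply/hasP; exists (images_of Y').
  apply: mem_tuples; first exact: size_images_of.
  apply/allP => y /mapP[i _ ->]; apply: mem_all_words; rewrite /Y' /=.
  case: ifP => // /hasP[[j b] jw /eqP /= <-].
  apply: leq_trans (szY _ jw); case: b {jw}; last exact: leqnn.
  by rewrite -[(j, true)]/(linv (j, false)) hY size_winv.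
have tE := images_ofK hY'.
have tE' l : supp w l.1 -> sub_of (images_of Y') l = Y l by move=> sl; rewrite tE /Y' sl.
apply/(goodP _ _ rv); split=> //.
- by move=> l; rewrite tE /Y'; case: ifP.
- move=> l m p sl sm sp; rewrite /nr_at !tE' //; exact: nY.
- by rewrite (eq_sb_supp tE') /feq e1 red_idem.
Qed.

End Enumeration.

Ltac cproj := lazymatch goal with
  | |- @computable _ _ _ _ (fun x => x) => exact: computable_id
  | |- @computable _ _ _ _ id => exact: computable_id
  | |- @computable _ _ _ _ fst => apply: (computable_fst (f := id)); exact: computable_id
  | |- @computable _ _ _ _ snd => apply: (computable_snd (f := id)); exact: computable_id
  | |- @computable _ _ _ _ (fun x => fst (@?f x)) => apply: (computable_fst (f := f)); cproj
  | |- @computable _ _ _ _ (fun x => snd (@?f x)) => apply: (computable_snd (f := f)); cproj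
  end.

(** * Computability of the search *)

Section ComputableWords.
Variable n : nat.
Notation L := ('I_n * bool)%type.

(** There are finitely many letters, so any function of a letter is a table. *)
Lemma computable_letter {A B : Type} {eA : Enc A} {eB : Enc B} (f : L -> B) (l : A -> L) :
  computable l -> computable (fun x => f (l x)).
Proof.
move=> cl; apply: (computable_switch (f := fun d _ => f d)) => //.
  exact: letter_code_inj.
by move=> d; apply: computable_const.
Qed.

Context {A : Type} {eA : Enc A}.

Lemma computable_push (l : A -> L) (s : A -> seq L) :
  computable l -> computable s -> computable (fun x => push (l x) (s x)).
Proof.
move=> cl cs.
have cg : computable (fun q : A * (L * seq L) =>
    if q.2.1 == linv (l q.1) then q.2.2 else l q.1 :: s q.1).
  have c1 : computable (fun q : A * (L * seq L) => q.1) by cproj.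
  apply: computable_if; last 2 first.
  - by cproj.
  - apply: computable_cons; first exact: computable_comp cl c1.
    exact: computable_comp cs c1.
  apply: (computable_eq (eqB := fun a b : L => a == b)).
  - by move=> a b; rewrite (inj_eq (@letter_code_inj n)).
  - by cproj.
  - by apply: computable_letter; apply: computable_comp cl c1.
have c0 : computable (fun x => [:: l x]) by apply: computable_cons => //; apply: computable_const.
have := computable_case cs c0 cg; apply: computable_ext => x /=.
by case: (s x).
Qed.

Lemma computable_winv (s : A -> seq L) : computable s -> computable (fun x => winv (s x)).
Proof.
move=> cs; apply: computable_rev.
apply: (computable_map (g := fun q : A * L => linv q.2)) => //.
by apply: computable_letter; cproj.
Qed.

Lemma computable_behead (g : A -> seq (seq L)) :
  computable g -> computable (fun x => behead (g x)).
Proof.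
move=> cg; have c2 : computable (fun q : A * (seq L * seq (seq L)) => q.2.2) by cproj.
have := computable_case cg (computable_const [::]) c2.
by apply: computable_ext => x; case: (g x).
Qed.

Lemma computable_head (g : A -> seq (seq L)) :
  computable g -> computable (fun x => head [::] (g x)).
Proof.
move=> cg; have c2 : computable (fun q : A * (seq L * seq (seq L)) => q.2.1) by cproj.
have := computable_case cg (computable_const [::]) c2.
by apply: computable_ext => x; case: (g x).
Qed.

End ComputableWords.

Section ComputableDecision.
Variable n : nat.
Notation L := ('I_n * bool)%type.
Context {A : Type} {eA : Enc A}.

Lemma computable_red (s : A -> seq L) : computable s -> computable (fun x => red (s x)).
Proof.
move=> cs; apply: (computable_foldr (g := fun q : A * (L * seq L) => push q.2.1 q.2.2)) => //.
  exact: computable_const.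
by apply: computable_push; cproj.
Qed.

Lemma computable_nth (g : A -> seq (seq L)) i :
  computable g -> computable (fun x => nth [::] (g x) i).
Proof.
elim: i g => [|i IHi] g cg.
  by have := computable_head cg; apply: computable_ext => x; rewrite nth0.
have := IHi _ (computable_behead cg); apply: computable_ext => x.
by rewrite nth_behead.
Qed.

Lemma computable_sub_of (g : A -> seq (seq L)) l :
  computable g -> computable (fun x => sub_of (g x) l).
Proof.
move=> cg; rewrite /sub_of; case: l.2; last exact: computable_nth.
by apply: computable_winv; apply: computable_nth.
Qed.

Lemma computable_canc (s t : A -> seq L) :
  computable s -> computable t -> computable (fun x => canc (s x) (t x)).
Proof.
move=> cs ct; apply: (computable_nat2 (@recs_sub 1)).
  by apply: (computable_nat2 (@recs_add 1)); apply: computable_size.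
by apply/computable_size/computable_red/computable_cat.
Qed.

Lemma computable_nr_test (g : A -> seq (seq L)) l m p :
  computable g -> computable (fun x => nr_test (g x) l m p).
Proof.
move=> cg; have cs l' := computable_sub_of l' cg.
apply: computable_and.
  by apply: computable_leq; [apply: computable_canc | apply: computable_size].
apply: computable_and.
  by apply: computable_leq; [apply: computable_canc | apply: computable_size].
apply: computable_leq; last by apply: (computable_nat2 (@recs_add 1)); apply: computable_size.
have := computable_nat2 (@recs_add 1) (computable_const 1)
  (computable_nat2 (@recs_add 1) (computable_canc (cs l) (cs m)) (computable_canc (cs m) (cs p))).
by apply: computable_ext => x; rewrite add1n.
Qed.

Lemma computable_letters_test (w : A -> seq L) (b : A -> L -> L -> L -> bool) :
  computable w -> (forall l m p, computable (fun x => b x l m p)) ->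
  computable (fun x => letters_test (w x) (b x)).
Proof.
move=> cw cb; apply: (computable_all_in (b := fun l x => all _ _)) => l _.
apply: (computable_all_in (b := fun m x => all _ _)) => m _.
apply: (computable_all_in (b := fun p x => if _ then _ else _)) => p _.
apply: computable_if => //; last exact: computable_const.
have ch (i : 'I_n) : computable (fun x => has (fun y : L => y.1 == i) (w x)).
  apply: (computable_has (g := fun q : A * L => q.2.1 == i)) => //.
  by apply: (computable_letter (fun y : L => y.1 == i)); cproj.
by do 3!(apply: computable_and => //); apply: computable_const.
Qed.

End ComputableDecision.

Section ComputableDecision2.
Variable n : nat.
Notation L := ('I_n * bool)%type.
Context {A : Type} {eA : Enc A}.

Lemma computable_sb (g : A -> seq (seq L)) (w : A -> seq L) :
  computable g -> computable w -> computable (fun x => sb (sub_of (g x)) (w x)).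
Proof.
move=> cg cw; apply: computable_flatten.
apply: (computable_map (g := fun q : A * L => sub_of (g q.1) q.2)) => //.
apply: (computable_switch (l := fun q : A * L => q.2) (f := fun d q => sub_of (g q.1) d)).
- exact: letter_code_inj.
- by cproj.
- by move=> d; apply: computable_sub_of; apply: computable_comp cg _; cproj.
Qed.

Lemma computable_good (g : A -> seq (seq L)) (w v : A -> seq L) :
  computable g -> computable w -> computable v ->
  computable (fun x => good (g x) (w x) (v x)).
Proof.
move=> cg cw cv; have ceq (s t : A -> seq L) :
    computable s -> computable t -> computable (fun x => s x == t x).
  by apply: (computable_eq (eqB := fun a b : seq L => a == b)); apply: word_en_eq.
apply: computable_and.
  apply: (computable_all_in (b := fun l x => _ == _)) => l _.
  by apply: ceq; first apply: computable_red; apply: computable_sub_of.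
apply: computable_and.
  apply: (computable_letters_test (b := fun x => nr_test (g x))) => // l m p.
  exact: computable_nr_test.
by apply: ceq => //; apply: computable_red; apply: computable_sb.
Qed.

End ComputableDecision2.

Section ComputableEnumeration.
Variable n : nat.
Notation L := ('I_n * bool)%type.
Context {A : Type} {eA : Enc A}.

Lemma computable_all_words (k : A -> nat) : computable k -> computable (fun x => all_words n (k x)).
Proof.
move=> ck; apply: (computable_iter (g := fun q : A * seq (seq L) =>
  [::] :: flatten [seq [seq l :: s | s <- q.2] | l <- enum {: L}])) => //.
  exact: computable_const.
apply: computable_cons; first exact: computable_const.
apply: computable_flatten.
apply: (@computable_map_in _ _ _ _ _ _
  (fun l (q : A * seq (seq L)) => [seq l :: s | s <- q.2])) => l.
apply: (computable_map (g := fun r : (A * seq (seq L)) * seq L => l :: r.2)); first by cproj.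
by apply: computable_cons; [apply: computable_const | cproj].
Qed.

Lemma computable_tuples k (S : A -> seq (seq L)) :
  computable S -> computable (fun x => tuples k (S x)).
Proof.
move=> cS; apply: (computable_iter (n := fun=> k) (g := fun q : A * seq (seq (seq L)) =>
  flatten [seq [seq y :: g | g <- q.2] | y <- S q.1])); [exact: computable_const..|].
apply: computable_flatten.
apply: (computable_map (g := fun r : (A * seq (seq (seq L))) * seq L =>
  [seq r.2 :: g | g <- r.1.2])).
  by apply: computable_comp cS _; cproj.
apply: (computable_map (g := fun r : ((A * seq (seq (seq L))) * seq L) * seq (seq L) =>
  r.1.2 :: r.2)); first by cproj.
by apply: computable_cons; cproj.
Qed.

Lemma computable_reach (W : seq (seq (seq L))) (k : A -> nat) (u : A -> seq L) :
  computable k -> computable u -> computable (fun x => reach W (k x) (u x)).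
Proof.
move=> ck cu; apply: (computable_iter (g := fun q : A * seq (seq L) => step W q.2)) => //.
  by apply: computable_cons => //; apply: computable_const.
apply: computable_cat; first by cproj.
apply: computable_flatten.
apply: (computable_map (g := fun r : (A * seq (seq L)) * seq L =>
  [seq red (sb (sub_of g) r.2) | g <- W])); first by cproj.
apply: (@computable_map_in _ _ _ _ _ _
  (fun g (r : (A * seq (seq L)) * seq L) => red (sb (sub_of g) r.2))) => g.
by apply: computable_red; apply: (computable_sb (g := fun=> g)); [apply: computable_const | cproj].
Qed.

End ComputableEnumeration.

Lemma computable_decide n (W : seq (seq (seq ('I_n * bool)))) :
  computable (fun p : seq ('I_n * bool) * seq ('I_n * bool) => decide W p.1 p.2).
Proof.
set P := (seq ('I_n * bool) * seq ('I_n * bool))%type.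
have cu : computable (fun p : P => red p.1) by apply: computable_red; cproj.
have cv : computable (fun p : P => red p.2) by apply: computable_red; cproj.
apply: (computable_has (g := fun q : P * seq ('I_n * bool) =>
  has (fun g => good g q.2 (red q.1.2)) (tuples n (all_words n (size (red q.1.2)))))).
  apply: computable_reach => //; apply/computable_size/computable_all_words.
  by apply: (computable_nat2 (@recs_add 1)); apply: computable_size.
have cv' : computable (fun q : P * seq ('I_n * bool) => red q.1.2) by apply: computable_red; cproj.
apply: (computable_has (g := fun r : (P * seq ('I_n * bool)) * seq (seq ('I_n * bool)) =>
  good r.2 r.1.2 (red r.1.1.2))).
  by apply/computable_tuples/computable_all_words/computable_size.
apply: computable_good; [by cproj | by cproj |].
by apply: computable_red; cproj.
Qed.

(** * Free groups *)

Section FreeGroup.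
Variable T : choiceType.

(** A concrete model: [free_basis] is a universal property, and mapping into this group shows that
    words with equal values in [F] have equal reduced forms. *)
Definition free_group := {w : seq (T * bool) | reduced w}.

HB.instance Definition _ := Choice.on free_group.

Definition fg (w : seq (T * bool)) : free_group := exist _ (red w) (red_reduced w).

Lemma fg_eq u v : feq u v -> fg u = fg v.
Proof. by move=> e; apply: val_inj. Qed.

Lemma fg_val (a : free_group) : fg (val a) = a.
Proof. by apply: val_inj; rewrite /= red_id // (valP a). Qed.

Definition fg_mul (a b : free_group) := fg (val a ++ val b).
Definition fg_inv (a : free_group) := fg (winv (val a)).

Lemma fg_mulE u v : fg_mul (fg u) (fg v) = fg (u ++ v).
Proof. by apply: fg_eq; apply: feq_cat; apply: feq_red. Qed.

Lemma fg_mulA : associative fg_mul.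
Proof. by move=> a b c; rewrite -[a]fg_val -[b]fg_val -[c]fg_val !fg_mulE catA. Qed.

Lemma fg_mul1 : left_id (fg [::]) fg_mul.
Proof. by move=> a; rewrite -[a]fg_val fg_mulE. Qed.

Lemma fg_mulr1 : right_id (fg [::]) fg_mul.
Proof. by move=> a; rewrite -[a]fg_val fg_mulE cats0. Qed.

Lemma fg_mulV : left_inverse (fg [::]) fg_inv fg_mul.
Proof.
by move=> a; rewrite -[X in fg_mul _ X]fg_val /fg_inv fg_mulE; apply/fg_eq/feq_winvl.
Qed.

Lemma fg_mulVr : right_inverse (fg [::]) fg_inv fg_mul.
Proof.
by move=> a; rewrite -[X in fg_mul X _]fg_val /fg_inv fg_mulE; apply/fg_eq/feq_winvr.
Qed.

HB.instance Definition _ :=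
  isGroup.Build free_group fg_mulA fg_mul1 fg_mulr1 fg_mulV fg_mulVr.

End FreeGroup.

Section Morphisms.
Variables (G H : groupType) (f : {multiplicative G -> H}).
Local Open Scope group_scope.

Lemma mul_morph1 : f 1 = 1.
Proof. by apply: (@mulgI _ (f 1)); rewrite -gmulfM !mulg1. Qed.

Lemma mul_morphV a : f a^-1 = (f a)^-1.
Proof. by apply: (@mulgI _ (f a)); rewrite -gmulfM !mulgV mul_morph1. Qed.

End Morphisms.

(** * Monomorphisms of F as injective substitutions of words *)

Section Evaluation.
Variables (n : nat) (F : groupType) (x : 'I_n -> F).
Notation L := ('I_n * bool)%type.
Local Open Scope group_scope.
Implicit Types (u v w : seq L).

Definition letter_eval (l : L) : F := if l.2 then (x l.1)^-1 else x l.1.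

Lemma word_eval_nil : word_eval x [::] = 1.
Proof. by rewrite /word_eval big_nil. Qed.

Lemma word_eval_cons l w : word_eval x (l :: w) = letter_eval l * word_eval x w.
Proof. by rewrite /word_eval big_cons. Qed.

Lemma word_eval_cat u v : word_eval x (u ++ v) = word_eval x u * word_eval x v.
Proof.
elim: u => [|l u IHu]; first by rewrite word_eval_nil mul1g.
by rewrite cat_cons !word_eval_cons IHu mulgA.
Qed.

Lemma letter_evalV l : letter_eval (linv l) = (letter_eval l)^-1.
Proof. by case: l => i []; rewrite /letter_eval /= ?invgK. Qed.

Lemma word_eval_winv w : word_eval x (winv w) = (word_eval x w)^-1.
Proof.
elim: w => [|l w IHw]; first by rewrite word_eval_nil invg1.
by rewrite winv_cons word_eval_cat IHw !word_eval_cons word_eval_nil mulg1 letter_evalV invgM.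
Qed.

Lemma word_eval_red w : word_eval x (red w) = word_eval x w.
Proof.
elim: w => //= l w IHw; rewrite word_eval_cons -IHw.
case: (red w) => [|m s] //=; first by rewrite word_eval_cons.
case: eqP => [-> | _]; last by rewrite word_eval_cons.
by rewrite word_eval_cons letter_evalV mulVKg.
Qed.

Lemma word_eval_feq u v : feq u v -> word_eval x u = word_eval x v.
Proof. by move=> e; rewrite -word_eval_red e word_eval_red. Qed.

Lemma morph_word_eval (f : {multiplicative F -> F}) (Y : L -> seq L) w :
  (forall l, f (letter_eval l) = word_eval x (Y l)) ->
  f (word_eval x w) = word_eval x (sb Y w).
Proof.
move=> fY; elim: w => [|l w IHw]; first by rewrite /= word_eval_nil mul_morph1.
by rewrite word_eval_cons gmulfM IHw fY sb_cons word_eval_cat.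
Qed.

Definition eval_fg (a : free_group 'I_n) : F := word_eval x (val a).

Lemma eval_fg_morph : {morph eval_fg : a b / a * b}.
Proof. by move=> a b; rewrite /eval_fg /= word_eval_red word_eval_cat. Qed.

HB.instance Definition _ := isMultiplicative.Build _ _ eval_fg eval_fg_morph.

Hypothesis x_basis : free_basis x.

Lemma free_basis_words : exists r : {multiplicative F -> free_group 'I_n},
  (forall a, word_eval x (val (r a)) = a) /\ (forall w, val (r (word_eval x w)) = red w).
Proof.
have [r [rx _]] := x_basis (fun i => fg [:: (i, false)]).
exists r; split.
  (* Both the identity and evaluation after [r] extend the basis map into [F] itself, so they agree
     by uniqueness. *)
  move=> a; have [f [_ f_uniq]] := x_basis x.
  have e1 := f_uniq idfun (fun _ => erefl) a.
  have e2 : eval_fg (r a) = f a.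
    apply: (f_uniq (eval_fg \o r : {multiplicative F -> F})) => i /=.
    by rewrite rx /eval_fg /= word_eval_cons word_eval_nil mulg1.
  by rewrite -[LHS]/(eval_fg (r a)) e2 -e1.
move=> w; rewrite -[red w]/(val (fg w)); congr val.
elim: w => [|l w IHw]; first by rewrite word_eval_nil mul_morph1.
rewrite word_eval_cons gmulfM IHw -cat1s -[fg (_ ++ _)]fg_mulE.
apply: (congr1 (fun a => fg_mul a (fg w))).
by case: l => i []; rewrite /letter_eval /= ?mul_morphV rx.
Qed.

Lemma mono_words u v :
  (exists f : {multiplicative F -> F}, injective f /\ f (word_eval x u) = word_eval x v) <->
  exists Y : L -> seq L,
    [/\ hom Y, forall l, reduced (Y l), inj_sub Y & feq (sb Y u) v].
Proof.
have [r [rK rE]] := free_basis_words.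
have eval_inj w w' : word_eval x w = word_eval x w' -> feq w w'.
  by move=> e; rewrite /feq -!rE e.
split=> [[f [inj_f fuv]] | [Y [hY rY jY e]]].
  pose Y l := val (r (f (letter_eval l))).
  have fY l : f (letter_eval l) = word_eval x (Y l) by rewrite rK.
  exists Y; split.
  - move=> l; rewrite /Y letter_evalV !mul_morphV /= red_id //.
    by rewrite reduced_winv (valP (r _)).
  - by move=> l; rewrite (valP (r _)).
  - move=> w /word_eval_feq; rewrite -(morph_word_eval _ fY) word_eval_nil -(mul_morph1 f).
    by move/inj_f => e; apply: eval_inj; rewrite e word_eval_nil.
  - by apply: eval_inj; rewrite -(morph_word_eval _ fY).
have [f [fx _]] := x_basis (fun i => word_eval x (Y (i, false))).
have fY l : f (letter_eval l) = word_eval x (Y l).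
  case: l => i []; rewrite /letter_eval /= ?mul_morphV fx //.
  by rewrite -word_eval_winv -hY.
exists f; split; last by rewrite (morph_word_eval _ fY); apply: word_eval_feq.
move=> a b; rewrite -(rK a) -(rK b); set p := val (r a); set q := val (r b).
rewrite !(morph_word_eval _ fY) => /eval_inj epq.
have /jY/word_eval_feq : feq (sb Y (p ++ winv q)) [::].
  rewrite sb_cat sb_winv //; apply: feq_trans (feq_winvr (sb Y q)).
  exact: feq_catr.
rewrite word_eval_cat word_eval_winv word_eval_nil => /(congr1 (fun a => a * word_eval x q)).
by rewrite mulgVK mul1g.
Qed.

End Evaluation.

(** All injective substitutions with images of length at most 5 are taken, the bound of [move_sub];
    they include every move at once, whatever word it is applied to. *)
Lemma move_substitutions n : exists W : seq (seq (seq ('I_n * bool))),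
  (forall g, g \in W -> inj_sub (sub_of (n := n) g)) /\
  (forall u v : seq ('I_n * bool), reduced u -> move u v ->
    exists2 g, g \in W & red (sb (sub_of (n := n) g) u) = v).
Proof.
have [W hW] := filter_prop (fun g => inj_sub (sub_of (n := n) g)) (tuples n (all_words n 5)).
exists W; split=> [g /hW[] // | u v ru /(move_sub ru)[f [hf f5 jf <-]]].
have fK := images_ofK hf.
exists (images_of f); last by rewrite (eq_sb _ fK).
apply/hW; split.
  apply: mem_tuples; first exact: size_images_of.
  by apply/allP => y /mapP[i _ ->]; apply: mem_all_words.
by move=> w; rewrite (eq_sb _ fK); apply: jf.
Qed.

Theorem theorem3p1 (n : nat) (F : groupType) (x : 'I_n -> F) :
  2 <= n -> free_basis x ->
  algorithmically_decidable (fun u v : word n =>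
    exists f : {multiplicative F -> F},
      injective f /\ f (word_eval x u) = word_eval x v).
Proof.
move=> n2 xb; have [W [Ws Wc]] := move_substitutions n.
apply: (computable_pred2 (computable_decide W)) => u v.
by rewrite (decideP Ws Wc n2); apply: iff_sym; apply: mono_words.
Qed.
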